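(* Let $-\infty<a<b<\infty$, $n\in\mathbb{N}$, $n-1<\alpha<n$, $0\le\beta\le1$, $\gamma=\alpha+\beta(n-\alpha)$, and let $\psi\in C^n[a,b]$ be real-valued and increasing with $\psi'(x)\neq0$ for all $x\in[a,b]$. If $f\in C^n[a,b]$, then $$ I_{a+}^{\alpha;\psi}\,{}^{H}\mathbb{D}_{a+}^{\alpha,\beta;\psi}f(x)=f(x)-\sum_{k=1}^{n}\frac{(\psi(x)-\psi(a))^{\gamma-k}}{\Gamma(\gamma-k+1)}\left[\left(\frac{1}{\psi'}\frac{d}{dx}\right)^{n-k}I_{a+}^{(1-\beta)(n-\alpha);\psi}f\right](a) $$ and $$ I_{b-}^{\alpha;\psi}\,{}^{H}\mathbb{D}_{b-}^{\alpha,\beta;\psi}f(x)=f(x)-\sum_{k=1}^{n}\frac{(-1)^{n-k}(\psi(b)-\psi(x))^{\gamma-k}}{\Gamma(\gamma-k+1)}\left[\left(\frac{1}{\psi'}\frac{d}{dx}\right)^{n-k}I_{b-}^{(1-\beta)(n-\alpha);\psi}f\right](b). $$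
   Context: For $\mu>0$: $I_{a+}^{\mu;\psi}f(x)=\frac{1}{\Gamma(\mu)}\int_a^x\psi'(t)(\psi(x)-\psi(t))^{\mu-1}f(t)\,dt$ and $I_{b-}^{\mu;\psi}f(x)=\frac{1}{\Gamma(\mu)}\int_x^b\psi'(t)(\psi(t)-\psi(x))^{\mu-1}f(t)\,dt$; for $\mu=0$ these are the identity. The $\psi$-Hilfer fractional derivatives of order $\alpha$ and type $\beta$ are ${}^{H}\mathbb{D}_{a+}^{\alpha,\beta;\psi}f=I_{a+}^{\beta(n-\alpha);\psi}\left(\frac{1}{\psi'}\frac{d}{dx}\right)^nI_{a+}^{(1-\beta)(n-\alpha);\psi}f$ and ${}^{H}\mathbb{D}_{b-}^{\alpha,\beta;\psi}f=I_{b-}^{\beta(n-\alpha);\psi}\left(-\frac{1}{\psi'}\frac{d}{dx}\right)^nI_{b-}^{(1-\beta)(n-\alpha);\psi}f$. Values at the endpoints $a$ and $b$ are understood as one-sided limits.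
   Formalization: Each formula is stated under the added assumption that the bracketed one-sided limits at a (resp. b) for k=1,…,n exist and are finite; for n≥2, β<1 they can be infinite (e.g. f=1), and then the formula is undefined. *)

(* Defs.v *)
From mathcomp Require Import all_boot all_order all_algebra.
From mathcomp Require Import all_classical all_reals all_analysis.

Set Implicit Arguments.
Unset Strict Implicit.
Unset Printing Implicit Defensive.

Import Order.TTheory GRing.Theory Num.Theory.
Import numFieldNormedType.Exports.

Local Open Scope ring_scope.
Local Open Scope classical_set_scope.

(* The value at x in [a, b] of a function that is significant on ]a, b[ only,
   such as a derivative: endpoint values are one-sided limits.  When such a
   limit does not exist, [lim] is a junk value, so convergence has to be asked
   for separately wherever it is not implied. *)
Definition endval (R : realType) (a b : R) (g : R -> R) (x : R) : R :=
  if x == a then lim (g y @[y --> a^'+])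
  else if x == b then lim (g y @[y --> b^'-])
  else g x.

(* f \in C^n[a, b].  The restriction of f to [a, b] is all that matters.  If the
   limit at a or b of the derivative of order k + 1 did not exist, then
   [endval] would not be continuous there; when it exists, it is the one-sided
   derivative at that endpoint, by the mean value theorem. *)
Definition Cn_on (R : realType) (n : nat) (a b : R) (f : R -> R) : Prop :=
  {within `[a, b], continuous f} /\
  forall k : nat, (k < n)%N ->
    {in `]a, b[, forall x, derivable (derive1n k f) x 1} /\
    {within `[a, b], continuous (endval a b (derive1n k.+1 f))}.

(* g = h on [a, b], where the values of g at a and b are one-sided limits; their
   existence is part of the claim. *)
Definition eq_with_endlim (R : realType) (a b : R) (g h : R -> R) : Prop :=
  [/\ {in `]a, b[, g =1 h},
      g x @[x --> a^'+] --> h a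
    & g x @[x --> b^'-] --> h b].

(* Euler's Gamma function, meaningful for 0 < z. *)
Definition Gamma (R : realType) (z : R) : R :=
  \int[lebesgue_measure]_(t in `]0, +oo[) (t `^ (z - 1) * expR (- t)).

Section psi_fractional_calculus.
Variables (R : realType) (psi : R -> R).

(* In the integrands below, derive1 psi is the two-sided derivative, hence
   meaningless at the ends of the domain of psi, and powR has a junk value at
   t = x when mu < 1; both concern a null set of t. *)
Definition fint_left (a mu : R) (f : R -> R) (x : R) : R :=
  if mu == 0 then f x
  else (Gamma mu)^-1 *
    \int[lebesgue_measure]_(t in `[a, x])
      (derive1 psi t * (psi x - psi t) `^ (mu - 1) * f t).

Definition fint_right (b mu : R) (f : R -> R) (x : R) : R :=
  if mu == 0 then f x
  else (Gamma mu)^-1 *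
    \int[lebesgue_measure]_(t in `[x, b])
      (derive1 psi t * (psi t - psi x) `^ (mu - 1) * f t).

Definition dpsi (f : R -> R) (x : R) : R := (derive1 psi x)^-1 * derive1 f x.

Definition hilfer_left (n : nat) (a alpha beta : R) (f : R -> R) : R -> R :=
  fint_left a (beta * (n%:R - alpha))
    (iter n dpsi (fint_left a ((1 - beta) * (n%:R - alpha)) f)).

Definition hilfer_right (n : nat) (b alpha beta : R) (f : R -> R) : R -> R :=
  fint_right b (beta * (n%:R - alpha))
    (iter n (fun g x => - dpsi g x)
      (fint_right b ((1 - beta) * (n%:R - alpha)) f)).

End psi_fractional_calculus.

(* Main.v *)
(* Writing f = F o p with p x = psi x - psi a (or psi b - psi x on the right) turns the
   psi-fractional integrals into Riemann-Liouville integrals, i.e. convolutions with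
   kern m t = t^(m-1) / Gamma m on t > 0, and (1/psi') d/dx into +-d/ds.  The kernels form a
   semigroup, kern m * kern n = kern (m + n).  With F_j the j-th derivative of F and
   c_j = F_j(0+), we have F_j = c_j + I^1 F_(j+1), hence, for xi = (1 - beta)(n - alpha),
     (I^xi F_j)' = c_j kern xi + I^xi F_(j+1)   (no singular term if xi = 0).
   If xi > 0, the existence of the one-sided limits of (I^xi F)^(i), i < n, forces
   c_0 = ... = c_(n-2) = 0 because kern xi blows up at 0, and then all these limits vanish;
   so (I^xi F)^(n) = c_(n-1) kern xi + I^xi F_n, and I^(n - xi) maps it to
   c_(n-1) kern n + I^n F_n = F.  If xi = 0, the claim is Taylor's formula
   F = sum_(j < n) c_j kern (j + 1) + I^n F_n. *)
From HB Require Import structures.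
Require Import Defs.
From mathcomp Require Import all_boot all_order all_algebra.
From mathcomp Require Import all_classical all_reals all_analysis.
From mathcomp Require Import measurable_realfun ring lra.

Set Implicit Arguments.
Unset Strict Implicit.
Unset Printing Implicit Defensive.

Import Order.TTheory GRing.Theory Num.Theory.
Import numFieldNormedType.Exports.

Local Open Scope ring_scope.
Local Open Scope classical_set_scope.

(** * Affine changes of variables *)

(** The obstacle is the singularity at 0 of the kernels of order below 1, which blocks
    differentiation under the integral sign. Derivatives are therefore found backwards: by the
    semigroup law, the function to be differentiated is I^1 of an explicit candidate, and the
    fundamental theorem of calculus shows that the candidate is its derivative. The semigroup law
    itself comes from Tonelli's theorem on the whole line, and its Beta-type constant from total
    masses against e^(-t). Nothing is known beforehand about the differentiability of the iterates
    of (1/psi') d/dx on I^xi f, so each induction carries a closed form of the current iterate. Both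
    endpoints share one argument: in the coordinate s = p x, the operator with its sign is d/ds on
    either side. The limits claimed at a and b need separate care, since the right-hand side may
    contain negative powers of a quantity tending to 0. The dichotomy that settles the formula
    settles them too: for xi > 0 all coefficients vanish, and for xi = 0 the exponents are natural
    numbers. *)

Section affine_substitution.
Context {R : realType}.
Notation mu := (@lebesgue_measure R).
Local Open Scope ereal_scope.

(** Both sides are measures in [A], so by uniqueness of Lebesgue measure it is enough to compare
    them on the intervals ]a, b]. For s < 0 the preimage is closed on the left instead, with the
    same length. *)
Lemma lebesgue_measure_affine (c s : R) (A : set R) : s != 0%R -> measurable A ->
  mu A = (`|s|%R)%:E * mu ((fun x => c + s * x)%R @^-1` A).
Proof.
move=> s0 mA.
pose phi : measurableTypeR R -> measurableTypeR R := (fun x => c + s * x)%R.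
have mphi : measurable_fun setT phi.
  by apply: measurable_funD => //; exact: measurable_funM.
have k0 : (0 <= `|s|)%R by [].
pose k : {nonneg R} := NngNum k0.
pose m_ : {measure set (measurableTypeR R) -> \bar R} := mscale k (pushforward mu phi).
pose m := m_ mphi.
rewrite -[RHS]/(m A).
apply: lebesgue_measure_unique => // _ [[a b] _] <-.
rewrite /m/= /mscale/= /pushforward.
have [sgt0|sle0] := ltP 0%R s.
  have -> : phi @^-1` `]a, b] = `]((a - c) / s)%R, ((b - c) / s)%R].
    apply/seteqP; split => x /=; rewrite !in_itv/= /phi ltr_pdivrMr// ler_pdivlMr//;
    by rewrite ltrBlDl lerBrDl ![(x * s)%R]mulrC.
  rewrite !lebesgue_measure_itv/= !lte_fin ltr_pM2r ?invr_gt0// ltrD2r.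
  case: ifPn => _; last by rewrite mule0.
  rewrite -!EFinD -EFinM gtr0_norm//; congr EFin; field; exact: s0.
have {sle0} slt0 : (s < 0)%R by rewrite lt_neqAle s0.
have -> : phi @^-1` `]a, b] = `[((b - c) / s)%R, ((a - c) / s)%R[.
  apply/seteqP; split => x /=; rewrite !in_itv/= /phi ltr_ndivlMr// ler_ndivrMr//;
  by rewrite ltrBlDl lerBrDl ![(x * s)%R]mulrC andbC.
rewrite !lebesgue_measure_itv/= !lte_fin ltr_nM2r ?invr_lt0// ltrD2r.
case: ifPn => _; last by rewrite mule0.
rewrite -!EFinD -EFinM ltr0_norm//; congr EFin; field; exact: s0.
Qed.

Lemma ge0_integral_affine (c s : R) (f : R -> \bar R) : s != 0%R ->
  measurable_fun setT f -> (forall x, 0 <= f x) ->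
  \int[mu]_x f x = (`|s|%R)%:E * \int[mu]_x f (c + s * x)%R.
Proof.
move=> s0 mf f0.
pose phi : measurableTypeR R -> measurableTypeR R := (fun x => c + s * x)%R.
have mphi : measurable_fun setT phi.
  by apply: measurable_funD => //; exact: measurable_funM.
have k0 : (0 <= `|s|)%R by [].
pose k : {nonneg R} := NngNum k0.
pose m_ : {measure set (measurableTypeR R) -> \bar R} := mscale k (pushforward mu phi).
transitivity (\int[m_ mphi]_x f x).
  by apply: eq_measure_integral => A mA _; exact: lebesgue_measure_affine.
by rewrite ge0_integral_mscale// ge0_integral_pushforward.
Qed.

Lemma ge0_integral_scale (s : R) (f : R -> \bar R) : (0 < s)%R ->
  measurable_fun setT f -> (forall x, 0 <= f x) ->
  \int[mu]_x f x = s%:E * \int[mu]_x f (s * x)%R.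
Proof.
move=> s0 mf f0; rewrite (@ge0_integral_affine 0%R s)// ?gt_eqF// gtr0_norm//.
by under eq_integral do rewrite add0r.
Qed.

Lemma ge0_integral_shift (c : R) (f : R -> \bar R) :
  measurable_fun setT f -> (forall x, 0 <= f x) ->
  \int[mu]_x f (x - c)%R = \int[mu]_x f x.
Proof.
move=> mf f0; rewrite [RHS](@ge0_integral_affine (- c)%R 1%R)// normr1 mul1e.
by apply: eq_integral => x _; rewrite mul1r addrC.
Qed.

End affine_substitution.

Section real_integral.
Context {R : realType}.
Notation mu := (@lebesgue_measure R).
Implicit Types (f g : R -> R) (D : set R).

(** A real integral is [fine] of a difference of two possibly infinite integrals. When one of them
    is infinite both sides here are 0, so the scaling laws below hold for measurable functions
    without integrability. *)
Lemma fine_gt0_mulB (s : R) (x y : \bar R) : (0 < s)%R -> (0 <= x)%E -> (0 <= y)%E ->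
  fine (s%:E * x - s%:E * y)%E = (s * fine (x - y)%E)%R.
Proof.
move=> s0; move: x y => [x| |] [y| |]//= _ _; rewrite ?gt0_muley//= ?lte_fin// ?mulr0//.
by rewrite mulrBr.
Qed.

Lemma Rintegral_ge0_split f D : \int[mu]_(x in D) f x =
  fine (\int[mu]_(x in D) (Num.max (f x) 0)%:E - \int[mu]_(x in D) (Num.max (- f x) 0)%:E)%E.
Proof.
rewrite /Rintegral integralE; congr (fine (_ - _)); apply: eq_integral => x _.
  by rewrite funeposE EFin_max.
by rewrite funenegE EFin_max.
Qed.

Lemma gt0_RintegralZl (k : R) f D : (0 < k)%R -> measurable D -> measurable_fun D f ->
  \int[mu]_(x in D) (k * f x) = (k * \int[mu]_(x in D) f x)%R.
Proof.
move=> k0 mD mf.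
have mfN : measurable_fun D (fun x => - f x)%R by exact: measurable_funN.
have Z g : measurable_fun D g -> (\int[mu]_(x in D) (Num.max (k * g x) 0)%:E =
    k%:E * \int[mu]_(x in D) (Num.max (g x) 0)%:E)%E.
  move=> mg; rewrite -ge0_integralZl; [|by []| | |].
  - by apply: eq_integral => x _; rewrite -EFinM maxr_pMr ?mulr0// ltW.
  - by apply/measurable_EFinP; exact: measurable_maxr.
  - by move=> x _; rewrite lee_fin le_max lexx orbT.
  - by rewrite lee_fin ltW.
rewrite !Rintegral_ge0_split; under [in X in (_ - X)%E]eq_integral do rewrite -mulrN.
by rewrite !Z// fine_gt0_mulB//; apply: integral_ge0 => x _; rewrite lee_fin le_max lexx orbT.
Qed.

Lemma Rintegral_affine (c s : R) f : s != 0 -> measurable_fun setT f ->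
  \int[mu]_x f x = `|s| * \int[mu]_x f (c + s * x).
Proof.
move=> s0 mf; rewrite !Rintegral_ge0_split.
have s0' : (0 < `|s|)%R by rewrite normr_gt0.
have mfN : measurable_fun setT (fun x => - f x)%R by exact: measurable_funN.
have Z g : measurable_fun setT g -> (\int[mu]_x (Num.max (g x) 0)%:E =
    `|s|%:E * \int[mu]_x (Num.max (g (c + s * x)%R) 0)%:E)%E.
  move=> mg; rewrite (@ge0_integral_affine _ c s) => [//|//||x].
    by apply/measurable_EFinP; exact: measurable_maxr.
  by rewrite lee_fin le_max lexx orbT.
rewrite (Z f)// (Z (fun x => - f x))//.
by rewrite fine_gt0_mulB//; apply: integral_ge0 => x _; rewrite lee_fin le_max lexx orbT.
Qed.

Lemma Rintegral_scale (s : R) f : 0 < s -> measurable_fun setT f ->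
  \int[mu]_x f x = s * \int[mu]_x f (s * x).
Proof.
move=> s0 mf; rewrite (@Rintegral_affine 0 s)// ?gt_eqF// gtr0_norm//.
by congr (_ * _); apply: eq_Rintegral => x _; rewrite add0r.
Qed.

End real_integral.

(** * The Gamma function *)

Section Gamma_function.
Context {R : realType}.
Notation mu := (@lebesgue_measure R).

Lemma bigcup_itv_invn : \bigcup_n `[n.+1%:R^-1, n.+1%:R]%classic = `]0, +oo[%classic :> set R.
Proof.
apply/seteqP; split => [x [n _] /=|x /=]; rewrite !in_itv/= ?andbT.
  by move=> /andP[+ _]; apply: lt_le_trans; rewrite invr_gt0.
move=> x0.
exists (maxn (Num.truncn x) (Num.truncn x^-1)) => //=.
rewrite in_itv/=; apply/andP; split.
  rewrite -[leRHS]invrK lef_pV2 ?posrE ?invr_gt0//.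
  apply/ltW/(lt_le_trans (truncnS_gt _)).
  by rewrite ler_nat ltnS leq_maxr.
apply/ltW/(lt_le_trans (truncnS_gt _)).
by rewrite ler_nat ltnS leq_maxl.
Qed.

Lemma itv_invn_nondecreasing :
  nondecreasing_seq (fun n : nat => `[n.+1%:R^-1, n.+1%:R]%classic : set R).
Proof.
move=> m n mn; apply/subsetPset => x /=; rewrite !in_itv/= => /andP[mx xm].
rewrite (le_trans _ mx) ?(le_trans xm) ?ler_nat//.
by rewrite lef_pV2 ?posrE// ler_nat.
Qed.

(** By monotone convergence the integral is the limit of those over [1/(n+1), n+1]; each is a
    difference of two values of [F], both in [0, C]. *)
Lemma ge0_integral_itv0y_le (f F : R -> R) (C : R) :
  (forall x, 0 < x -> 0 <= f x) ->
  {in `]0, +oo[, continuous f} ->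
  (forall x : R, 0 < x -> is_derive x 1 F (f x)) ->
  (forall x, 0 < x -> 0 <= F x <= C) ->
  (\int[mu]_(x in `]0%R, +oo[) (f x)%:E <= C%:E)%E.
Proof.
move=> f0 cf dF FC.
have itv0 (n : nat) (x : R) : x \in `[n.+1%:R^-1, n.+1%:R]%R -> 0 < x.
  by rewrite in_itv/= => /andP[+ _]; apply: lt_le_trans; rewrite invr_gt0.
have cfn (n : nat) : {within `[n.+1%:R^-1, n.+1%:R], continuous f}.
  apply: continuous_in_subspaceT => x /[!inE] /itv0 x0.
  by apply: cf; rewrite inE/= in_itv/= x0.
have mf : measurable_fun (`]0, +oo[ : set R) f by exact: open_continuous_measurable_fun.
rewrite -bigcup_itv_invn.
have sub (n : nat) : `[n.+1%:R^-1, n.+1%:R]%classic `<=` (`]0, +oo[%classic : set R).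
  by move=> x /= /itv0; rewrite in_itv/= andbT.
have cvgI := @ge0_nondecreasing_set_cvg_integral _ (measurableTypeR R) R _ (EFin \o f) mu
  itv_invn_nondecreasing.
apply: cvge_le (cvgI _ _ _); last 3 first.
- by [].
- by move=> n; apply/measurable_EFinP; apply: measurable_funS mf => //.
- by move=> n x /= /itv0 x0; rewrite lee_fin f0.
near=> n.
(* For n = 0 the interval reduces to the point 1, so n >= 1 is imposed before the fundamental
   theorem is used. *)
have n1 : (n.+1%:R^-1 < n.+1%:R :> R)%R.
  rewrite (@lt_le_trans _ _ 1)// ?ler1n// invf_lt1 ?ltr1n//.
  by near: n; exists 1%N.
have gt0 : 0 < n.+1%:R^-1 :> R by rewrite invr_gt0.
have Fc x : 0 < x -> {for x, continuous F}.
  move=> x0; apply: differentiable_continuous; apply/derivable1_diffP.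
  by have [] := dF x x0.
rewrite (@continuous_FTC2 _ f F)//.
- rewrite -EFinB lee_fin; have /andP[_] := FC n.+1%:R (lt_trans gt0 n1).
  by have /andP[+ _] := FC _ gt0; lra.
- split.
  + by move=> x xn; have [] := dF x (itv0 n x (subset_itv_oo_cc xn)).
  + by apply: cvg_at_right_filter; exact: Fc.
  + by apply: cvg_at_left_filter; apply: Fc; exact: lt_trans n1.
- move=> x xn; have := dF x (itv0 n x (subset_itv_oo_cc xn)).
  by move=> dFx; rewrite derive1E derive_val.
Unshelve. all: by end_near. Qed.

(* The right-hand side is, up to the constant, the derivative of the bounded function
   (t / (1 + t))^z. *)
Lemma powR_expRN_le (z t : R) : 0 < z -> 0 < t ->
  t `^ (z - 1) * expR (- t) <=
  (z + 1) `^ (z + 1) / z * (z * (t / (1 + t)) `^ (z - 1) * (1 + t) ^- 2).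
Proof.
move=> z0 t0.
have t1 : 0 < 1 + t by rewrite addr_gt0.
have z1 : 0 < z + 1 by rewrite addr_gt0.
(* From 1 + u <= e^u at u = t / (z + 1) follows 1 + t <= (z + 1) e^(t / (z + 1)); raising this to
   the power z + 1 produces the constant. *)
have bnd : (1 + t) `^ (z + 1) <= (z + 1) `^ (z + 1) * expR t.
  have -> : expR t = expR (t / (z + 1)) `^ (z + 1).
    by rewrite -expRM divfK// gt_eqF.
  rewrite -powRM ?expR_ge0 ?(ltW z1)//; apply: ge0_ler_powR.
  - exact: ltW.
  - by rewrite nnegrE ltW.
  - by rewrite nnegrE mulr_ge0 ?expR_ge0// ltW.
  apply: (@le_trans _ _ ((z + 1) * (1 + t / (z + 1)))).
    have -> : (z + 1) * (1 + t / (z + 1)) = z + 1 + t.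
      by field; rewrite gt_eqF.
    by lra.
  by rewrite ler_pM2l// expR_ge1Dx.
rewrite powRM ?invr_ge0 ?(ltW t0) ?(ltW t1)//.
have -> : (1 + t)^-1 `^ (z - 1) = (1 + t) ^+ 2 / (1 + t) `^ (z + 1).
  rewrite -powR_inv1 ?(ltW t1)// -powRrM.
  rewrite -powR_mulrn ?(ltW t1)// -powRB ?(gt_eqF t1) ?implybT//.
  by congr powR; ring.
set A := (z + 1) `^ (z + 1); set B := t `^ (z - 1).
have C0 : 0 < (1 + t) `^ (z + 1) by rewrite powR_gt0.
set C := (1 + t) `^ (z + 1) in bnd C0 *.
have -> : A / z * (z * (B * ((1 + t) ^+ 2 / C)) * (1 + t) ^- 2) = B * (A / C).
  by field; rewrite !gt_eqF.
apply: ler_wpM2l; first exact: powR_ge0.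
by rewrite expRN ler_pdivlMr// mulrC ler_pdivrMr// expR_gt0.
Qed.

Lemma measurable_Gamma_integrand (z : R) (D : set R) :
  measurable_fun D (fun t => t `^ (z - 1) * expR (- t)).
Proof.
apply: measurable_funTS; apply: measurable_funM.
  exact: measurable_powR.
by apply: measurableT_comp => //; exact: measurable_expR.
Qed.

Lemma is_derive1_continuous (f : R -> R) (x d : R) :
  is_derive x 1 f d -> {for x, continuous f}.
Proof.
by move=> [df _]; apply: differentiable_continuous; apply/derivable1_diffP.
Qed.

Lemma is_derive_inv1D (t : R) : 0 < t ->
  is_derive t 1 (fun t => (1 + t)^-1) (- (1 + t) ^- 2).
Proof.
move=> t0; have t1 : 1 + t != 0 by rewrite gt_eqF// addr_gt0.
have d1 : is_derive t 1 (fun t => 1 + t) (1 : R).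
  apply: is_derive_eq (is_deriveD (is_derive_cst (1 : R) t 1) (is_derive_id t 1)) _.
  by rewrite add0r.
apply: is_derive_eq (is_deriveV t1 d1) _.
by rewrite /GRing.scale/= mulr1.
Qed.

Lemma is_derive_div1D (t : R) : 0 < t ->
  is_derive t 1 (fun t => t / (1 + t)) ((1 + t) ^- 2).
Proof.
move=> t0; have t1 : 1 + t != 0 by rewrite gt_eqF// addr_gt0.
apply: is_derive_eq (is_deriveM (is_derive_id t 1) (is_derive_inv1D t0)) _ => /=.
by rewrite /GRing.scale/=; field.
Qed.

Lemma Gamma_lty (z : R) : 0 < z ->
  (\int[mu]_(t in `]0%R, +oo[) (t `^ (z - 1) * expR (- t))%:E < +oo)%E.
Proof.
move=> z0.
pose g t : R := z * (t / (1 + t)) `^ (z - 1) * (1 + t) ^- 2.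
have tp (t : R) : 0 < t -> 0 < t / (1 + t).
  by move=> t0; rewrite divr_gt0// addr_gt0.
have dG (t : R) : 0 < t -> is_derive t 1 (fun t => (t / (1 + t)) `^ z) (g t).
  move=> t0.
  exact: (@is_derive1_comp _ (fun u => u `^ z) (fun t => t / (1 + t)) t _ _
    (is_derive1_powR z (tp _ t0)) (is_derive_div1D t0)).
have g0 (t : R) : 0 < t -> 0 <= g t.
  by move=> t0; rewrite /g !mulr_ge0 ?powR_ge0 ?invr_ge0 ?exprn_ge0 ?addr_ge0// ltW.
have cg : {in (`]0, +oo[ : set R), continuous g}.
  move=> t; rewrite inE/= in_itv/= andbT => t0.
  apply: cvgM; first apply: cvgM; first exact: cvg_cst.
    exact: is_derive1_continuous
      (@is_derive1_comp _ (fun u => u `^ (z - 1)) (fun t => t / (1 + t)) t _ _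
        (is_derive1_powR (z - 1) (tp _ t0)) (is_derive_div1D t0)).
  have c := is_derive1_continuous (is_derive_inv1D t0).
  have -> : (fun u : R => (1 + u) ^- 2) = (fun u => (1 + u)^-1 * (1 + u)^-1).
    by apply/funext => u; rewrite -exprVn expr2.
  by rewrite -exprVn expr2; exact: (cvgM c c).
have mg : measurable_fun (`]0, +oo[ : set R) g.
  exact: open_continuous_measurable_fun.
have ig : (\int[mu]_(t in `]0%R, +oo[) (g t)%:E <= 1)%E.
  apply: (@ge0_integral_itv0y_le g (fun t => (t / (1 + t)) `^ z)) => // t t0.
  rewrite powR_ge0/=.
  rewrite -[leRHS](_ : 1 `^ z = 1); last by rewrite powR1.
  apply: ge0_ler_powR; rewrite ?nnegrE//; [exact: ltW|exact: ltW (tp _ t0)|].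
  by rewrite ler_pdivrMr ?mul1r ?lerDr// addr_gt0.
pose C := (z + 1) `^ (z + 1) / z.
have C0 : 0 <= C by rewrite divr_ge0 ?powR_ge0// ltW.
apply: (@le_lt_trans _ _ (\int[mu]_(t in `]0%R, +oo[) (C%:E * (g t)%:E))%E).
  apply: ge0_le_integral => //.
  - by move=> t _; rewrite lee_fin mulr_ge0 ?powR_ge0 ?expR_ge0.
  - by apply/measurable_EFinP; exact: measurable_Gamma_integrand.
  - by apply/measurable_EFinP; exact: measurable_funM.
  - move=> t /=; rewrite in_itv/= andbT => t0.
    by rewrite -EFinM lee_fin; exact: powR_expRN_le.
rewrite ge0_integralZl//.
- apply: (@le_lt_trans _ _ (C%:E * 1)%E); last by rewrite mule1 ltry.
  by apply: lee_wpmul2l; rewrite ?lee_fin.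
- exact/measurable_EFinP.
- by move=> t /=; rewrite in_itv/= andbT => t0; rewrite lee_fin g0.
Qed.

Lemma EFin_Gamma (z : R) : 0 < z -> (Gamma z)%:E =
  (\int[mu]_(t in `]0%R, +oo[) (t `^ (z - 1) * expR (- t))%:E)%E.
Proof.
move=> z0; rewrite /Gamma /Rintegral fineK// ge0_fin_numE ?Gamma_lty//.
by apply: integral_ge0 => t _; rewrite lee_fin mulr_ge0 ?powR_ge0 ?expR_ge0.
Qed.

Lemma Gamma_gt0 (z : R) : 0 < z -> 0 < Gamma z.
Proof.
move=> z0; rewrite -lte_fin EFin_Gamma//.
(* A lower bound of the integrand on [1, 2]: there t^(z - 1) >= t^(-1) >= 1/2 because z > 0, and
   e^(-t) >= e^(-2). *)
pose c : R := 2^-1 * expR (- 2).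
have c0 : 0 < c by rewrite mulr_gt0 ?expR_gt0 ?invr_gt0.
apply: (@lt_le_trans _ _ (\int[mu]_(t in `[1%R, 2%R]) c%:E)%E).
  rewrite integral_cst//= lebesgue_measure_itv/= lte_fin ltr1n/= -EFinD -EFinM.
  by rewrite lte_fin mulr_gt0// subr_gt0 ltr1n.
have itv12 (t : R) : t \in `[1, 2]%R -> 0 < t by rewrite in_itv/=; lra.
apply: (@le_trans _ _
    (\int[mu]_(t in `[1%R, 2%R]) (t `^ (z - 1) * expR (- t))%:E)%E).
  apply: ge0_le_integral => //.
  - by move=> t _; rewrite lee_fin ltW.
  - by apply/measurable_EFinP; exact: measurable_Gamma_integrand.
  - move=> t /[dup] /itv12 t0 /=.
    rewrite in_itv/= => /andP[t1 t2]; rewrite lee_fin.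
    apply: ler_pM; rewrite ?invr_ge0 ?expR_ge0 ?ler_expR ?lerN2//.
    apply: (@le_trans _ _ (t `^ (-1))).
      by rewrite powR_inv1 ?(ltW t0)// lef_pV2 ?posrE.
    by apply: ler_powR => //; lra.
apply: ge0_subset_integral => //.
- by apply/measurable_EFinP; exact: measurable_Gamma_integrand.
- by move=> t _; rewrite lee_fin mulr_ge0 ?powR_ge0 ?expR_ge0.
- by move=> t /itv12; rewrite /= in_itv/= andbT.
Qed.

(** The integrand is the density of the exponential law of rate 1. *)
Lemma Gamma1 : Gamma 1 = 1 :> R.
Proof.
apply: EFin_inj; rewrite EFin_Gamma// -(@integral_exponential_pdf R 1)//.
transitivity (\int[mu]_(t in `[0%R, +oo[) (expR (- t))%:E)%E.
  rewrite -integral_itv_obnd_cbnd.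
    by apply: eq_integral => t _; rewrite subrr powRr0 mul1r.
  apply/measurable_EFinP; apply: measurable_funTS.
  by apply: measurableT_comp => //; exact: measurable_expR.
rewrite integral_mkcond; apply: eq_integral => t _.
by rewrite /exponential_pdf !patchE; case: ifP => // _; rewrite mul1r mulN1r.
Qed.

End Gamma_function.

(** * Fractional integrals as convolutions *)

Section kernel.
Context {R : realType}.
Notation mu := (@lebesgue_measure R).
Implicit Types m n s t : R.

Definition kern m t : R := if 0 < t then t `^ (m - 1) / Gamma m else 0.

Lemma kern_ge0 m t : 0 < m -> 0 <= kern m t.
Proof.
by move=> m0; rewrite /kern; case: ifP => // _; rewrite divr_ge0 ?powR_ge0 ?ltW ?Gamma_gt0.
Qed.

Lemma kern_gt0E m t : 0 < t -> kern m t = t `^ (m - 1) / Gamma m.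
Proof. by rewrite /kern => ->. Qed.

Lemma kern_le0 m t : t <= 0 -> kern m t = 0.
Proof. by rewrite /kern ltNge => ->. Qed.

Lemma kern1 t : 0 < t -> kern 1 t = 1.
Proof. by move=> t0; rewrite kern_gt0E// subrr powRr0 Gamma1 divr1. Qed.

Lemma measurable_kern m : measurable_fun setT (kern m).
Proof.
apply: measurable_fun_ifT.
- exact: measurable_fun_ltr.
- by apply: measurable_funM => //; exact: measurable_powR.
- by [].
Qed.

Lemma kern_scale m s t : 0 < s -> kern m (s * t) = s `^ (m - 1) * kern m t.
Proof.
move=> s0; rewrite /kern pmulr_rgt0//; case: ifP => t0; last by rewrite mulr0.
by rewrite powRM ?(ltW s0) ?(ltW t0)// mulrA.
Qed.

Lemma continuous_kern m t : 0 < t -> {for t, continuous (kern m)}.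
Proof.
move=> t0.
have : {for t, continuous (fun t => t `^ (m - 1) / Gamma m)}.
  by apply: cvgM; [exact: is_derive1_continuous (is_derive1_powR _ t0)|exact: cvg_cst].
rewrite /prop_for /continuous_at -kern_gt0E//; apply: cvg_trans.
apply: near_eq_cvg; near=> u; rewrite kern_gt0E//.
by near: u; exact: lt_nbhsr.
Unshelve. all: by end_near. Qed.

Lemma cvg_kern0 m : 1 < m -> kern m s @[s --> 0^'+] --> 0.
Proof.
move=> m1.
have : (s `^ (m - 1) / Gamma m) @[s --> 0^'+] --> 0 / Gamma m.
  by apply: cvgMl; apply: powR_cvg0; rewrite subr_gt0.
rewrite mul0r; apply: cvg_trans; apply: near_eq_cvg; near=> u.
by rewrite kern_gt0E.
Unshelve. all: by end_near. Qed.

Local Open Scope ereal_scope.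

Lemma integral_kern_expRN m : (0 < m)%R ->
  \int[mu]_t (kern m t * expR (- t))%:E = 1.
Proof.
move=> m0.
transitivity (\int[mu]_(t in `]0%R, +oo[) ((Gamma m)^-1%:E * (t `^ (m - 1) * expR (- t))%:E)).
  rewrite [RHS]integral_mkcond; apply: eq_integral => t _.
  rewrite patchE /kern; have [t0|t0] := ltP 0%R t.
    rewrite ifT ?inE/= ?in_itv/= ?t0// -EFinM; congr EFin; ring.
  by rewrite mul0r ifF// memNset//= in_itv/= andbT; apply/negP; rewrite -leNgt.
rewrite ge0_integralZl//; last 3 first.
- by apply/measurable_EFinP; exact: measurable_Gamma_integrand.
- by move=> t _; rewrite lee_fin mulr_ge0 ?powR_ge0 ?expR_ge0.
- by rewrite lee_fin invr_ge0 ltW// Gamma_gt0.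
by rewrite -EFin_Gamma// -EFinM mulVf// gt_eqF// Gamma_gt0.
Qed.

Lemma measurable_kernB m : measurable_fun setT (fun z : R * R => kern m (z.1 - z.2)).
Proof. by apply: measurableT_comp; [exact: measurable_kern|exact: measurable_funB]. Qed.

(** Kept in the extended reals, since finiteness is only known once the value has been computed. *)
Let conv m n s := \int[mu]_t (kern m (s - t) * kern n t)%:E.

Let conv_ge0 m n s : (0 < m)%R -> (0 < n)%R -> 0 <= conv m n s.
Proof. by move=> m0 n0; apply: integral_ge0 => t _; rewrite lee_fin mulr_ge0 ?kern_ge0. Qed.

Let measurable_integrand m n s :
  measurable_fun setT (fun t => (kern m (s - t) * kern n t)%R).
Proof.
apply: measurable_funM; last exact: measurable_kern.
by apply: measurableT_comp; [exact: measurable_kern|exact: measurable_funB].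
Qed.

Let conv_le0 m n s : (s <= 0)%R -> conv m n s = 0.
Proof.
move=> s0; rewrite /conv integral0_eq// => t _; congr EFin.
have [t0|t0] := leP t 0%R; first by rewrite (kern_le0 n t0) mulr0.
by rewrite (@kern_le0 m (s - t)) ?mul0r// subr_le0 (le_trans s0)// ltW.
Qed.

(** Each kernel is homogeneous, so the substitution of s t for t makes the convolution homogeneous
    of degree m + n - 1. Only the constant [conv m n 1], a Beta integral, remains unknown. *)
Let conv_scale m n s : (0 < m)%R -> (0 < n)%R -> (0 < s)%R ->
  conv m n s = (s `^ (m + n - 1))%:E * conv m n 1.
Proof.
move=> m0 n0 s0; rewrite /conv (@ge0_integral_scale _ s _ s0); last 2 first.
- by apply/measurable_EFinP; exact: measurable_integrand.
- by move=> t; rewrite lee_fin mulr_ge0 ?kern_ge0.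
have -> : (s `^ (m + n - 1) = s * (s `^ (m - 1) * s `^ (n - 1)))%R.
  have -> : (m + n - 1 = 1 + ((m - 1) + (n - 1)))%R by ring.
  rewrite (@powRD _ s 1) ?(gt_eqF s0) ?implybT// powRr1 ?(ltW s0)//.
  by rewrite (@powRD _ s (m - 1)) ?(gt_eqF s0) ?implybT.
rewrite EFinM -muleA; congr mule.
rewrite -ge0_integralZl//; last 3 first.
- by apply/measurable_EFinP; exact: measurable_integrand.
- by move=> t _; rewrite lee_fin mulr_ge0 ?kern_ge0.
- by rewrite lee_fin mulr_ge0 ?powR_ge0.
apply: eq_integral => t _; rewrite -EFinM; congr EFin.
have -> : (s - s * t = s * (1 - t))%R by ring.
by rewrite (kern_scale m (1 - t) s0) (kern_scale n t s0) mulrACA.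
Qed.

(* [kern m t * expR (- t)] is a probability density; hence so is the convolution of two
   of them, which determines the constant left undetermined by scaling. *)
Lemma conv_kern m n s : (0 < m)%R -> (0 < n)%R ->
  \int[mu]_t (kern m (s - t) * kern n t)%:E = (kern (m + n) s)%:E.
Proof.
move=> m0 n0; have mn0 : (0 < m + n)%R by rewrite addr_gt0.
rewrite -/(conv m n s).
have [s0|s0] := leP s 0%R; first by rewrite conv_le0// kern_le0.
have mE k : measurable_fun setT (fun t : R => (kern k t * expR (- t))%R).
  apply: measurable_funM; first exact: measurable_kern.
  by apply: measurableT_comp => //; exact: measurable_expR.
(* The factor e^(-s) = e^(-(s - t)) e^(-t) is shared between the two kernels, and Tonelli's theorem
   separates the integrals. *)
have total : \int[mu]_s ((expR (- s))%:E * conv m n s) = 1.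
  pose h (z : R * R) : \bar R := (kern m (z.1 - z.2) * expR (- (z.1 - z.2)) *
    (kern n z.2 * expR (- z.2)))%:E.
  have fub : \int[mu]_u \int[mu]_t h (u, t) = \int[mu]_t \int[mu]_u h (u, t).
    apply: fubini_tonelli => [|z].
      apply/measurable_EFinP; apply: measurable_funM.
        by apply: (measurableT_comp (mE m)); exact: measurable_funB.
      exact: (measurableT_comp (mE n)).
    by rewrite lee_fin !mulr_ge0 ?kern_ge0 ?expR_ge0.
  transitivity (\int[mu]_u \int[mu]_t h (u, t)).
    apply: eq_integral => u _; rewrite -ge0_integralZl; [| exact: measurableT | | | ].
    2: by apply/measurable_EFinP; exact: measurable_integrand.
    2: by move=> t _; rewrite lee_fin mulr_ge0 ?kern_ge0.
    2: by rewrite lee_fin expR_ge0.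
    apply: eq_integral => t _; rewrite -EFinM; congr EFin.
    have -> : (- u = - (u - t) + - t)%R by ring.
    by rewrite expRD [RHS]mulrACA mulrC.
  rewrite fub -[RHS](integral_kern_expRN n0); apply: eq_integral => t _.
  rewrite /h/=; under eq_integral do rewrite EFinM.
  rewrite ge0_integralZr; [| exact: measurableT | | | ].
  - rewrite (@ge0_integral_shift _ t (fun u => (kern m u * expR (- u))%:E)).
    + by rewrite (integral_kern_expRN m0) mul1e.
    + exact/measurable_EFinP.
    + by move=> u; rewrite lee_fin mulr_ge0 ?kern_ge0 ?expR_ge0.
  - apply/measurable_EFinP; apply: (measurableT_comp (mE m)); exact: measurable_funB.
  - by move=> u _; rewrite lee_fin mulr_ge0 ?kern_ge0 ?expR_ge0.
  - by rewrite lee_fin mulr_ge0 ?kern_ge0 ?expR_ge0.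
(* By homogeneity the total mass is [conv m n 1] times the integral of s^(m + n - 1) e^(-s). This
   also rules out an infinite [conv m n 1]. *)
have : (Gamma (m + n))%:E * conv m n 1 = 1.
  rewrite -total EFin_Gamma// -ge0_integralZr; [| by [] | | | ].
  2: by apply/measurable_EFinP; exact: measurable_Gamma_integrand.
  2: by move=> t _; rewrite lee_fin mulr_ge0 ?powR_ge0 ?expR_ge0.
  2: exact: conv_ge0.
  rewrite integral_mkcond; apply: eq_integral => t _; rewrite patchE.
  case: ifPn; rewrite ?notin_setE ?inE/= in_itv/= andbT => t0.
    by rewrite (conv_scale m0 n0 t0) EFinM [RHS]muleA; congr (_ * _); exact: muleC.
  by rewrite conv_le0 ?mule0// leNgt; apply/negP.
have G0 := Gamma_gt0 mn0.
have := conv_ge0 1%R m0 n0; rewrite (conv_scale m0 n0 s0).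
case: (conv m n 1) => [c _|_|//].
- rewrite -!EFinM => -[GC]; congr EFin; rewrite (kern_gt0E _ s0); congr (_ * _)%R.
  by apply: (@mulfI _ (Gamma (m + n))); rewrite ?gt_eqF// GC divff// gt_eqF.
- by rewrite gt0_muley ?lte_fin.
Qed.

End kernel.

#[global] Opaque kern.

(** * Convolution of causal functions with the kernels *)

Section convolution.
Context {R : realType}.
Notation mu := (@lebesgue_measure R).
Implicit Types (m n s t r : R) (P Q : R -> R).

(* Vanishing on ]-oo, 0] makes integration from 0 to s a convolution over the whole line. *)
Definition causal P := [/\ measurable_fun setT P, (forall r, r <= 0 -> P r = 0) &
  forall T, exists2 M, 0 <= M & forall r, r <= T -> `|P r| <= M].

Definition convol m P s : R := \int[mu]_r (kern m (s - r) * P r).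

Definition convolvable m P s :=
  mu.-integrable setT (fun r => (kern m (s - r) * P r)%:E).

Lemma measurable_kern_subr m s : measurable_fun setT (fun r => kern m (s - r)).
Proof. by apply: measurableT_comp; [exact: measurable_kern|exact: measurable_funB]. Qed.

Lemma convolvable_kern m n s : 0 < m -> 0 < n -> convolvable m (kern n) s.
Proof.
move=> m0 n0; apply/integrableP; split.
  apply/measurable_EFinP; apply: measurable_funM; last exact: measurable_kern.
  exact: measurable_kern_subr.
under eq_integral do rewrite /= ger0_norm ?mulr_ge0 ?kern_ge0//.
by rewrite conv_kern// ltry.
Qed.

Lemma convol_kern m n s : 0 < m -> 0 < n -> convol m (kern n) s = kern (m + n) s.
Proof. by move=> m0 n0; rewrite /convol /Rintegral conv_kern. Qed.

(** [kern 1] is the indicator of r > 0, so the bound is integrable in r with integral M * kern (m +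
    1) s. It is the dominating function used from here on. *)
Lemma kern_mul_le m P M s r : 0 < m -> (forall r, r <= 0 -> P r = 0) ->
  (forall r, r < s -> `|P r| <= M) ->
  `|kern m (s - r) * P r| <= M * (kern m (s - r) * kern 1 r).
Proof.
move=> m0 P0 PM; rewrite normrM (ger0_norm (kern_ge0 _ m0)).
have [r0|r0] := leP r 0; first by rewrite P0// normr0 (kern_le0 1 r0) !mulr0.
have [rs|sr] := ltP r s.
  by rewrite (kern1 r0) mulr1 mulrC ler_wpM2r ?kern_ge0 ?PM.
by rewrite (@kern_le0 _ m (s - r)) ?subr_le0// !mul0r mulr0.
Qed.

Lemma causal_convolvable m P s : 0 < m -> causal P -> convolvable m P s.
Proof.
move=> m0 [mP P0 /(_ s)[M M0 PM]].
rewrite /convolvable.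
apply: (@le_integrable _ _ _ mu setT measurableT _
  (fun r => (M%:E * (kern m (s - r) * kern 1 r)%:E)%E)).
- apply/measurable_EFinP; apply: measurable_funM => //.
  exact: measurable_kern_subr.
- move=> r _; rewrite /= lee_fin; apply: le_trans (ler_norm _).
  by apply: kern_mul_le => // u /ltW; exact: PM.
- exact/integrableZl/convolvable_kern.
Qed.

Lemma normr_convol_le m P M s : 0 < m -> causal P ->
  (forall r, r < s -> `|P r| <= M) -> `|convol m P s| <= M * kern (m + 1) s.
Proof.
move=> m0 cP PM; have [_ P0 _] := cP.
apply: (le_trans (le_normr_Rintegral _ (causal_convolvable s m0 cP))) => //.
rewrite -(convol_kern s m0 ltr01)// /convol.
rewrite -(RintegralZl _ _ (convolvable_kern s m0 ltr01))//.
apply: le_Rintegral => //.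
- exact: integrable_abse (causal_convolvable s m0 cP).
- have := integrableZl measurableT M (convolvable_kern s m0 ltr01).
  by apply: eq_integrable => // r _; rewrite EFinM.
- by move=> r _; exact: kern_mul_le.
Qed.

Lemma convolD m P Q s : convolvable m P s -> convolvable m Q s ->
  convol m (fun r => P r + Q r) s = convol m P s + convol m Q s.
Proof.
move=> iP iQ; rewrite /convol -RintegralD//.
by apply: eq_Rintegral => r _; rewrite mulrDr.
Qed.

Lemma convolB m P Q s : convolvable m P s -> convolvable m Q s ->
  convol m (fun r => P r - Q r) s = convol m P s - convol m Q s.
Proof.
move=> iP iQ; rewrite /convol -RintegralB//.
by apply: eq_Rintegral => r _; rewrite mulrBr.
Qed.

Lemma convolvableZ m k P s : convolvable m P s -> convolvable m (fun r => k * P r) s.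
Proof.
move=> iP; have := integrableZl measurableT k iP.
by apply: eq_integrable => // r _; rewrite -EFinM; congr EFin; ring.
Qed.

Lemma convolZ m k P s : convolvable m P s ->
  convol m (fun r => k * P r) s = k * convol m P s.
Proof.
move=> iP; rewrite /convol -RintegralZl//.
by apply: eq_Rintegral => r _; ring.
Qed.

Lemma eq_convol m P Q s : (forall r, r < s -> P r = Q r) -> convol m P s = convol m Q s.
Proof.
move=> PQ; apply: eq_Rintegral => r _; have [/PQ -> //|sr] := ltP r s.
by rewrite kern_le0 ?subr_le0// !mul0r.
Qed.

Lemma causal_pos P : causal P -> causal (fun r => Num.max (P r) 0).
Proof.
move=> [mP P0 PM]; split; first exact: measurable_maxr.
- by move=> r r0; rewrite P0// maxxx.
- move=> T; have [M M0 {}PM] := PM T; exists M => // r /PM.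
  by case: (leP 0 (P r)) => // _ _; rewrite normr0.
Qed.

Lemma causalN P : causal P -> causal (fun r => - P r).
Proof.
move=> [mP P0 PM]; split; first exact: measurable_funN.
- by move=> r r0; rewrite P0// oppr0.
- move=> T; have [M M0 {}PM] := PM T; exists M => // r /PM.
  by rewrite normrN.
Qed.

(** Tonelli's theorem handles nonnegative functions only; this reduces signed ones to them by
    linearity. *)
Lemma causal_decomp P : causal P -> exists Q1 Q2,
  [/\ causal Q1, causal Q2, forall r, 0 <= Q1 r, forall r, 0 <= Q2 r &
      P = (fun r => Q1 r - Q2 r)].
Proof.
move=> cP; exists (fun r => Num.max (P r) 0), (fun r => Num.max (- P r) 0).
split; [exact: causal_pos|exact/causal_pos/causalN|..].
- by move=> r; rewrite le_max lexx orbT.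
- by move=> r; rewrite le_max lexx orbT.
- apply/funext => r; case: (leP (P r) 0) => Pr.
    by rewrite max_l ?oppr_ge0// opprK add0r.
  by rewrite max_r ?oppr_le0 ?ltW// subr0.
Qed.

Lemma EFin_convol m P s : 0 < m -> causal P ->
  (convol m P s)%:E = (\int[mu]_r (kern m (s - r) * P r)%:E)%E.
Proof.
move=> m0 cP; rewrite /convol /Rintegral fineK//.
exact: integrable_fin_num (causal_convolvable s m0 cP).
Qed.

Lemma measurable_convol m P : 0 < m -> causal P -> measurable_fun setT (convol m P).
Proof.
move=> m0 cP.
have ge0_case Q : causal Q -> (forall r, 0 <= Q r) -> measurable_fun setT (convol m Q).
  move=> cQ Q0; have [mQ _ _] := cQ; apply/measurable_EFinP.
  rewrite (_ : _ \o _ = fun s => (\int[mu]_r (kern m (s - r) * Q r)%:E)%E); last first.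
    by apply/funext => s; rewrite /= EFin_convol.
  have := @measurable_fun_fubini_tonelli_F _ _ (measurableTypeR R) (measurableTypeR R) R
    mu (fun z => (kern m (z.1 - z.2) * Q z.2)%:E).
  apply => [|z].
    apply/measurable_EFinP; apply: measurable_funM; first exact: measurable_kernB.
    exact: measurableT_comp.
  by rewrite lee_fin mulr_ge0 ?kern_ge0.
have [Q1 [Q2 [c1 c2 Q10 Q20 ->]]] := causal_decomp cP.
rewrite (_ : convol _ _ = fun s => convol m Q1 s - convol m Q2 s).
  by apply: measurable_funB; exact: ge0_case.
by apply/funext => s; rewrite convolB//; exact: causal_convolvable.
Qed.

Lemma convol_le0 m P s : (forall r, r <= 0 -> P r = 0) -> s <= 0 -> convol m P s = 0.
Proof.
move=> P0 s0; rewrite (@eq_convol m P (fun=> 0)).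
  by rewrite /convol /Rintegral integral0_eq// => r _; rewrite mulr0.
by move=> r rs; rewrite P0// ltW// (lt_le_trans rs).
Qed.

Lemma le_kern m s t : 1 <= m -> 0 < s -> s <= t -> kern m s <= kern m t.
Proof.
move=> m1 s0 st; have t0 := lt_le_trans s0 st; rewrite !kern_gt0E//.
apply: ler_wpM2r; first by rewrite invr_ge0 ltW// Gamma_gt0// (lt_le_trans ltr01).
by apply: ge0_ler_powR => //; rewrite ?subr_ge0 ?nnegrE// ltW.
Qed.

Lemma causal_convol m P : 0 < m -> causal P -> causal (convol m P).
Proof.
move=> m0 cP; have [_ P0 PM] := cP; split; first exact: measurable_convol.
- by move=> s s0; exact: convol_le0.
- move=> T; have [M M0 {}PM] := PM T.
  have K0 t : 0 <= kern (m + 1) t by rewrite kern_ge0// addr_gt0.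
  exists (M * kern (m + 1) (Num.max T 1)) => [|s sT]; first by rewrite mulr_ge0.
  have [s0|s0] := leP s 0; first by rewrite convol_le0// normr0 mulr_ge0.
  apply: (@le_trans _ _ (M * kern (m + 1) s)).
    by apply: normr_convol_le => // r rs; apply: PM; rewrite ltW// (lt_le_trans rs).
  apply: ler_wpM2l => //; apply: le_kern => //; first by rewrite lerDr ltW.
  by rewrite le_max sT.
Qed.

(** For nonnegative [P], Tonelli's theorem brings the two kernels together, and the shift u -> u - r
    turns their integral into the one computed by [conv_kern]. *)
Lemma convolA m n P s : 0 < m -> 0 < n -> causal P ->
  convol m (convol n P) s = convol (m + n) P s.
Proof.
move=> m0 n0 cP; have mn0 : 0 < m + n by rewrite addr_gt0.
have ge0_case Q : causal Q -> (forall r, 0 <= Q r) ->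
    convol m (convol n Q) s = convol (m + n) Q s.
  move=> cQ Q0; have [mQ _ _] := cQ; apply: EFin_inj.
  rewrite (EFin_convol _ m0 (causal_convol n0 cQ)) EFin_convol//.
  pose h (z : R * R) : \bar R := (kern m (s - z.1) * (kern n (z.1 - z.2) * Q z.2))%:E.
  have fub : (\int[mu]_u \int[mu]_t h (u, t) = \int[mu]_t \int[mu]_u h (u, t))%E.
    apply: fubini_tonelli => [|z]; last by rewrite lee_fin !mulr_ge0 ?kern_ge0.
    apply/measurable_EFinP; apply: measurable_funM.
      exact: (measurableT_comp (measurable_kern_subr m s)).
    apply: measurable_funM; first exact: measurable_kernB.
    exact: measurableT_comp.
  transitivity (\int[mu]_u \int[mu]_t h (u, t))%E.
    apply: eq_integral => u _; rewrite EFinM (EFin_convol _ n0 cQ).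
    rewrite -ge0_integralZl; [|exact: measurableT| | |].
    - by apply: eq_integral => t _; rewrite /h -EFinM.
    - apply/measurable_EFinP; apply: measurable_funM; last exact: mQ.
      exact: measurable_kern_subr.
    - by move=> r _; rewrite lee_fin mulr_ge0 ?kern_ge0.
    - by rewrite lee_fin kern_ge0.
  rewrite fub; apply: eq_integral => r _; rewrite /h/=.
  transitivity (\int[mu]_u ((kern m (s - u) * kern n (u - r))%:E * (Q r)%:E))%E.
    by apply: eq_integral => u _; rewrite -EFinM mulrA.
  have ck : (\int[mu]_u (kern m (s - u) * kern n (u - r))%:E = (kern (m + n) (s - r))%:E)%E.
    rewrite -(conv_kern (s - r) m0 n0).
    rewrite -(@ge0_integral_shift _ r (fun u => (kern m (s - r - u) * kern n u)%:E)).
    - apply: eq_integral => u _.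
      by have -> : s - r - (u - r) = s - u by ring.
    - apply/measurable_EFinP; apply: measurable_funM; last exact: measurable_kern.
      exact: measurable_kern_subr.
    - by move=> u; rewrite lee_fin mulr_ge0 ?kern_ge0.
  rewrite ge0_integralZr; [|exact: measurableT| | |].
  - by rewrite ck EFinM.
  - apply/measurable_EFinP; apply: measurable_funM; first exact: measurable_kern_subr.
    by apply: measurableT_comp; [exact: measurable_kern|exact: measurable_funB].
  - by move=> u _; rewrite lee_fin mulr_ge0 ?kern_ge0.
  - by rewrite lee_fin.
have [Q1 [Q2 [c1 c2 Q10 Q20 ->]]] := causal_decomp cP.
rewrite (_ : convol n _ = fun s => convol n Q1 s - convol n Q2 s); last first.
  by apply/funext => t; rewrite convolB//; exact: causal_convolvable.
rewrite !convolB ?ge0_case//; apply: causal_convolvable => //; exact: causal_convol.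
Qed.

End convolution.

(** * Semigroup law, limit at 0 and continuity of fractional integrals *)

Section fractional_integral.
Context {R : realType}.
Notation mu := (@lebesgue_measure R).
Implicit Types (m n s t r c : R) (P Q : R -> R).

(** The kernel of order 0 would be a Dirac mass, which is not a function; hence the separate
    case. *)
Definition frac_int m P s : R := if m == 0 then P s else convol m P s.

Lemma frac_int0 P : frac_int 0 P = P.
Proof. by apply/funext => s; rewrite /frac_int eqxx. Qed.

Lemma frac_int_gt0 m P : 0 < m -> frac_int m P = convol m P.
Proof. by move=> m0; apply/funext => s; rewrite /frac_int gt_eqF. Qed.

Lemma causal_frac_int m P : 0 <= m -> causal P -> causal (frac_int m P).
Proof.
rewrite le_eqVlt => /predU1P[<-|m0]; first by rewrite frac_int0.
by rewrite frac_int_gt0//; exact: causal_convol.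
Qed.

Lemma frac_intA m n P : 0 <= m -> 0 <= n -> causal P ->
  frac_int m (frac_int n P) = frac_int (m + n) P.
Proof.
rewrite le_eqVlt => /predU1P[<-|m0]; first by rewrite frac_int0 add0r.
rewrite le_eqVlt => /predU1P[<-|n0] cP; first by rewrite frac_int0 addr0.
rewrite !frac_int_gt0// ?addr_gt0//.
by apply/funext => s; exact: convolA.
Qed.

Lemma eq_frac_int m P Q s : (forall r, r <= s -> P r = Q r) ->
  frac_int m P s = frac_int m Q s.
Proof.
move=> PQ; rewrite /frac_int; case: ifP => _; first exact: PQ.
by apply: eq_convol => r /ltW; exact: PQ.
Qed.

(* The form taken by the derivatives of a fractional integral of order n. *)
Definition sing_part c n P s : R := c * kern n s + frac_int n P s.

(** For n < 1 the kernel is unbounded near 0, so a singular part need not be causal and [frac_intA]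
    does not cover it. The two terms are integrated separately. *)
Lemma frac_int_sing_part m n c P s : 0 <= m -> 0 < n -> causal P ->
  frac_int m (sing_part c n P) s = sing_part c (m + n) P s.
Proof.
rewrite le_eqVlt => /predU1P[<- _ _|m0 n0 cP]; first by rewrite frac_int0 add0r.
have ik := convolvable_kern s m0 n0.
have ip : convolvable m (convol n P) s.
  exact/(causal_convolvable s m0)/causal_convol.
rewrite /sing_part !frac_int_gt0// ?addr_gt0//.
rewrite convolD//; last exact: convolvableZ.
by rewrite convolZ// convol_kern// convolA.
Qed.

(** With a bound of [P] on ]-oo, 1], [normr_convol_le] makes the integral O(s^m). *)
Lemma cvg_frac_int0 m P : 0 < m -> causal P -> frac_int m P s @[s --> 0^'+] --> 0.
Proof.
move=> m0 cP; have [_ P0 /(_ 1)[M M0 PM]] := cP.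
rewrite frac_int_gt0//.
have K0 : (M * kern (m + 1) s) @[s --> 0^'+] --> (0 : R).
  rewrite -[X in _ --> X](mulr0 M); apply: cvgMr; apply: cvg_kern0.
  by rewrite ltrDr.
have K0N : (- (M * kern (m + 1) s)) @[s --> 0^'+] --> (0 : R).
  by rewrite -[X in _ --> X]oppr0; exact: cvgN.
apply: (squeeze_cvgr _ K0N K0); near=> s.
rewrite -ler_norml; apply: normr_convol_le => // r rs; apply: PM.
apply/ltW/(lt_le_trans rs); near: s; exact: nbhs_right_le.
Unshelve. all: by end_near. Qed.

(** The substitution of s r for r moves the dependence on s from the singular kernel to the argument
    of [P], so that a bound uniform in s is available for continuity under the integral sign. *)
Lemma convol_scale m P s : 0 < m -> causal P -> 0 < s ->
  convol m P s = s * (s `^ (m - 1) * \int[mu]_r (kern m (1 - r) * P (s * r))).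
Proof.
move=> m0 cP s0; have [mP P0 PM] := cP.
rewrite /convol (@Rintegral_scale _ s _ s0); last first.
  by apply: measurable_funM => //; exact: measurable_kern_subr.
congr (_ * _); rewrite -RintegralZl//.
  apply: eq_Rintegral => r _.
  by rewrite -{1}(mulr1 s) -mulrBr kern_scale// mulrA.
have [M M0 {}PM] := PM s.
apply: (@le_integrable _ _ _ mu setT measurableT _
  (fun r => (M%:E * (kern m (1 - r) * kern 1 r)%:E)%E)).
- apply/measurable_EFinP; apply: measurable_funM; first exact: measurable_kern_subr.
  apply: measurableT_comp; first exact: mP.
  exact: measurable_funM.
- move=> r _ /=; rewrite lee_fin; apply: le_trans (ler_norm _).
  apply: (@kern_mul_le _ m (fun r => P (s * r))) => //.
  + by move=> u u0; apply: P0; rewrite pmulr_rle0.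
  + by move=> u u1; apply: PM; rewrite ger_pMr// ltW.
- exact/integrableZl/convolvable_kern.
Qed.

Lemma continuous_frac_int m P (L s : R) : 0 <= m -> causal P ->
  (forall t, 0 < t < L -> {for t, continuous P}) -> 0 < s < L ->
  {for s, continuous (frac_int m P)}.
Proof.
rewrite le_eqVlt => /predU1P[<-|m0] cP cont sL; first by rewrite frac_int0; exact: cont.
have /andP[s0 sL'] := sL; have [mP P0 /(_ L)[M M0 PM]] := cP.
rewrite frac_int_gt0//.
pose I t := \int[mu]_r (kern m (1 - r) * P (t * r)).
have bound t r : 0 < t < L ->
    `|kern m (1 - r) * P (t * r)| <= M * (kern m (1 - r) * kern 1 r).
  move=> /andP[t0 tL]; apply: (@kern_mul_le _ m (fun r => P (t * r))) => //.
  - by move=> u u0; apply: P0; rewrite pmulr_rle0.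
  - move=> u u1; apply: PM; apply: le_trans (ltW tL).
    by rewrite ger_pMr// ltW.
have Ig : mu.-integrable setT (fun r => (M * (kern m (1 - r) * kern 1 r))%:E).
  have := integrableZl measurableT M (convolvable_kern 1 m0 ltr01).
  by apply: eq_integrable => // r _; rewrite EFinM.
have cI : {for s, continuous I}.
  have sin : s \in (`]0, L[%classic : set R) by rewrite inE/= in_itv/=.
  apply: (@continuity_under_integral _ _ _ mu (fun t r => kern m (1 - r) * P (t * r))
    setT measurableT 0 L _ _ _ Ig _ _ sin).
  - move=> t /=; rewrite in_itv/= => tL.
    apply: (@le_integrable _ _ _ mu setT measurableT _ _ _ _ Ig).
      apply/measurable_EFinP; apply: measurable_funM; first exact: measurable_kern_subr.
      apply: measurableT_comp; first exact: mP.
      exact: measurable_funM.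
    move=> r _ /=; rewrite lee_fin; apply: le_trans (ler_norm _).
    exact: bound.
  - apply: aeW => r _ t; rewrite inE/= in_itv/= => /andP[t0 tL].
    have [r1|r1] := leP 1 r.
      rewrite (_ : (fun u => _) = cst 0); first exact: cvg_cst.
      by apply/funext => u; rewrite kern_le0 ?subr_le0// mul0r.
    apply: cvgM; first exact: cvg_cst.
    have [r0|r0] := leP r 0.
      rewrite (P0 (t * r)) ?pmulr_rle0//.
      apply: cvg_near_cst; near=> u; apply: P0; rewrite pmulr_rle0//.
      by near: u; exact: lt_nbhsr.
    apply: (@cvg_comp _ _ _ (fun u => u * r) P _ (nbhs (t * r))).
      by apply: cvgM; [exact: cvg_id|exact: cvg_cst].
    apply: cont; rewrite mulr_gt0//=; apply: lt_trans tL.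
    by rewrite gtr_pMr.
  - move=> t /=; rewrite in_itv/= => tL; apply: aeW => r _.
    exact: bound.
have : {for s, continuous (fun t => t * (t `^ (m - 1) * I t))}.
  apply: cvgM; first exact: cvg_id.
  apply: cvgM; last exact: cI.
  exact: is_derive1_continuous (is_derive1_powR (m - 1) s0).
rewrite /prop_for /continuous_at -(convol_scale m0 cP s0); apply: cvg_trans.
apply: near_eq_cvg; near=> t; apply/esym/convol_scale => //.
by near: t; exact: lt_nbhsr.
Unshelve. all: by end_near. Qed.

Lemma convol1E P : measurable_fun setT P -> (forall r, r <= 0 -> P r = 0) ->
  convol 1 P = fun y => \int[mu]_(r in `]0, y]) P r.
Proof.
move=> mP P0; apply/funext => y.
transitivity (\int[mu]_(r in `]0, y[) P r); last first.
  rewrite /Rintegral integral_itv_bndo_bndc//.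
  by apply/measurable_EFinP; exact: measurable_funTS.
rewrite [RHS]Rintegral_mkcond; apply: eq_Rintegral => r _; rewrite patchE.
case: ifPn; rewrite ?notin_setE ?inE/= in_itv/=.
  by move=> /andP[r0 ry]; rewrite kern1 ?mul1r// subr_gt0.
move=> /negP; rewrite negb_and -!leNgt => /orP[r0|yr]; first by rewrite P0// mulr0.
by rewrite kern_le0 ?mul0r// subr_le0.
Qed.

(** Integrability is assumed rather than causality because [P] will be a singular part, possibly
    unbounded near 0. *)
Lemma is_derive_convol1 P s : measurable_fun setT P -> (forall r, r <= 0 -> P r = 0) ->
  (forall u, convolvable 1 P u) -> 0 < s -> {for s, continuous P} ->
  is_derive s 1 (convol 1 P) (P s).
Proof.
move=> mP P0 iP s0 cP; rewrite convol1E//.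
(* The kernel [kern 1 (s + 2 - r)] equals 1 on all of ]0, s + 1]; with s + 1 in place of s + 2 it
   would be 0 at the right end. *)
have iu : mu.-integrable `]0, (s + 1)] (EFin \o P).
  have sub : `]0, (s + 1)]%classic `<=` [set: R] by [].
  have := @integrableS _ (measurableTypeR R) R mu setT _ _ measurableT
    (measurable_itv `]0, (s + 1)]%R) sub (iP (s + 2)).
  apply: eq_integrable => // r; rewrite inE/= in_itv/= => /andP[r0 rs].
  by rewrite kern1 ?mul1r// subr_gt0 (le_lt_trans rs)// ltrD2l ltr1n.
have ss1 : s < s + 1 by rewrite ltrDl.
have s0' : (BRight 0 < BRight s)%O by rewrite bnd_simp.
have [d e] := @continuous_FTC1 R P (BRight 0) s (s + 1) ss1 iu s0' cP.
by apply: DeriveDef; [exact: d|rewrite -derive1E; exact: e].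
Qed.

End fractional_integral.

(** * Derivatives of fractional integrals *)

Section local_equality.
Context {R : realType}.

Lemma near_itvoo (a b x : R) : a < x < b -> \forall t \near x, a < t < b.
Proof. by move=> /andP[ax xb]; apply: filterS2 (lt_nbhsr ax) (lt_nbhsl xb) => t -> ->. Qed.

Lemma near_eq_is_derive1 (f g : R -> R) (x d : R) : (\forall t \near x, f t = g t) ->
  is_derive x 1 f d -> is_derive x 1 g d.
Proof.
move=> fg [df <-]; apply: DeriveDef.
  exact: near_eq_derivable df.
exact/esym/near_eq_derive.
Qed.

End local_equality.

Section chain.
Context {R : realType}.
Implicit Types (m s t r : R) (P : R -> R).
Variables (L : R) (n : nat) (F : nat -> R -> R) (c : nat -> R).
Hypothesis causalF : forall j, (j <= n)%N -> causal (F j).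
Hypothesis continuousF : forall j s, (j <= n)%N -> 0 < s < L -> {for s, continuous (F j)}.
Hypothesis primF : forall j s, (j < n)%N -> 0 < s < L ->
  F j s = c j + frac_int 1 (F j.+1) s.

(** Writing the constant of integration as c_j times the step function [kern 1] makes the identity
    valid for r <= 0 as well, so that a fractional integral can be applied to both sides. *)
Let F_sing j r : (j < n)%N -> r < L -> F j r = sing_part (c j) 1 (F j.+1) r.
Proof.
move=> jn rL; have [r0|r0] := leP r 0.
  have [_ F0 _] := causalF (ltnW jn); have [_ FS0 _] := causalF jn.
  by rewrite /sing_part F0// kern_le0// frac_int_gt0// convol_le0// mulr0 addr0.
by rewrite /sing_part kern1// mulr1 primF ?r0.
Qed.

Let frac_intF m j s : 0 <= m -> (j < n)%N -> s < L ->
  frac_int m (F j) s = sing_part (c j) (m + 1) (F j.+1) s.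
Proof.
move=> m0 jn sL; rewrite (@eq_frac_int _ m (F j) (sing_part (c j) 1 (F j.+1))).
  by rewrite frac_int_sing_part//; exact: causalF.
by move=> r rs; apply: F_sing => //; exact: le_lt_trans sL.
Qed.

Lemma fractional_taylor k s : (k <= n)%N -> 0 < s < L ->
  F 0%N s = \sum_(0 <= j < k) c j * kern j.+1%:R s + frac_int k%:R (F k) s.
Proof.
move=> kn sL; have /andP[_ sL'] := sL.
elim: k kn => [_|k IH kn]; first by rewrite big_geq// add0r frac_int0.
rewrite (IH (ltnW kn)) big_nat_recr//= -addrA; congr (_ + _).
by rewrite (frac_intF (ler0n _ _) kn sL') natr1.
Qed.

(** The orders m and 1 commute, so for m > 0 the function is near s the integral of order 1 of the
    asserted derivative. For m = 0 it is c_j plus such an integral, and the constant disappears. *)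
Lemma is_derive_frac_intF m j s : 0 <= m -> (j < n)%N -> 0 < s < L ->
  is_derive s 1 (frac_int m (F j))
    ((if m == 0 then 0 else c j) * kern m s + frac_int m (F j.+1) s).
Proof.
move=> m0 jn sL; have /andP[s0 sL'] := sL.
have local g d : (forall t, 0 < t < L -> g t = frac_int m (F j) t) ->
    is_derive s 1 g d -> is_derive s 1 (frac_int m (F j)) d.
  move=> gE; apply: near_eq_is_derive1.
  by apply: filterS (near_itvoo sL) => t; exact: gE.
have [m00|m00] := eqVneq m 0.
  apply: (local (fun t => c j + convol 1 (F j.+1) t)).
    by move=> t tL; rewrite m00 frac_int0 primF// frac_int_gt0.
  have [mS S0 _] := causalF jn.
  have dS : is_derive s 1 (convol 1 (F j.+1)) (F j.+1 s).
    apply: is_derive_convol1 => //; last exact: continuousF.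
    by move=> u; apply: causal_convolvable => //; exact: causalF.
  apply: is_derive_eq (is_deriveD (is_derive_cst (c j) s (1 : R)) dS) _.
  by rewrite m00 frac_int0 mul0r.
have {m00}mp : 0 < m by rewrite lt_neqAle eq_sym m00.
apply: (local (convol 1 (sing_part (c j) m (F j.+1)))).
  move=> t /andP[t0 tL]; rewrite (frac_intF m0 jn tL) -(frac_int_gt0 _ ltr01).
  by rewrite (frac_int_sing_part _ t ler01 mp (causalF jn)) (addrC 1).
rewrite -/(sing_part _ _ _ s).
apply: is_derive_convol1 => //.
- apply: measurable_funD.
    by apply: measurable_funM => //; exact: measurable_kern.
  by have [] := causal_frac_int m0 (causalF jn).
- move=> r r0; have [_ Z _] := causal_frac_int m0 (causalF jn).
  by rewrite /sing_part Z// kern_le0// mulr0 addr0.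
- move=> u.
  have i1 := convolvableZ (c j) (convolvable_kern u ltr01 mp).
  have i2 := causal_convolvable u ltr01 (causal_frac_int m0 (causalF jn)).
  have := integrableD measurableT i1 i2.
  by apply: eq_integrable => // r _; rewrite /= -EFinD -mulrDr.
- apply: cvgD.
    by apply: cvgM; [exact: cvg_cst|exact: continuous_kern].
  apply: (continuous_frac_int (L := L)) => //; first exact: causalF.
  by move=> t; exact: continuousF.
Qed.

End chain.

(** * Expansion in the coordinate s = p x *)

Section chart.
Context {R : realType}.
Implicit Types (s t r x : R) (P : R -> R).
(* D i is the i-th iterate of +-(1/psi') d/dx on the fractional integral of f; since its
   differentiability is only known once D i has been computed, it is specified through
   the chain rule alone.  E is the one-sided filter at the endpoint where p = 0. *)
Variables (a b L xi : R) (n : nat) (F : nat -> R -> R) (c : nat -> R) (p : R -> R).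
Variables (E : set_system R) (D : nat -> R -> R).
Hypothesis E_filter : ProperFilter E.
Hypothesis L_gt0 : 0 < L.
Hypothesis xi_itv : 0 <= xi < 1.
Hypothesis n_gt0 : (0 < n)%N.
Hypothesis causalF : forall j, (j <= n)%N -> causal (F j).
Hypothesis continuousF : forall j s, (j <= n)%N -> 0 < s < L -> {for s, continuous (F j)}.
Hypothesis primF : forall j s, (j < n)%N -> 0 < s < L ->
  F j s = c j + frac_int 1 (F j.+1) s.
Hypothesis p_itv : forall x, a < x < b -> 0 < p x < L.
Hypothesis p_cvg : p x @[x --> E] --> 0^'+.
Hypothesis E_itv : \forall x \near E, a < x < b.
Hypothesis D0 : forall x, a < x < b -> D 0%N x = frac_int xi (F 0%N) (p x).
Hypothesis DS : forall i (G G' : R -> R), (i < n)%N ->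
  (forall x, a < x < b -> D i x = G (p x)) ->
  (forall s, 0 < s < L -> is_derive s 1 G (G' s)) ->
  forall x, a < x < b -> D i.+1 x = G' (p x).
Hypothesis D_cvg : forall i, (i < n)%N -> cvg (D i x @[x --> E]).

Let xi0 : 0 <= xi. Proof. by have /andP[] := xi_itv. Qed.
Let xi1 : xi < 1. Proof. by have /andP[] := xi_itv. Qed.

Let p_comp (G : R -> R) (l : R) : G s @[s --> 0^'+] --> l -> G (p x) @[x --> E] --> l.
Proof. by move=> Gl; apply: (@cvg_comp _ _ _ p G E 0^'+). Qed.

Let D_lim i (G : R -> R) (l : R) : (forall x, a < x < b -> D i x = G (p x)) ->
  G s @[s --> 0^'+] --> l -> D i x @[x --> E] --> l.
Proof.
move=> DG Gl; have := p_comp Gl; apply: cvg_trans; apply: near_eq_cvg.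
by apply: filterS E_itv => x /DG.
Qed.

Let frac_intF_cvg0 m i : 0 < m -> (i <= n)%N -> frac_int m (F i) s @[s --> 0^'+] --> 0.
Proof. by move=> m0 iL; apply: cvg_frac_int0 => //; exact: causalF. Qed.

(* A finite limit of [c * kern xi + o(1)] at 0 forces [c = 0], [kern xi] being unbounded. *)
Let sing_cvg k i : 0 < xi -> (i < n)%N ->
  (forall x, a < x < b -> D i x = k * kern xi (p x) + frac_int xi (F i) (p x)) -> k = 0.
Proof.
move=> xi_gt0 iln DE; have := D_cvg iln => /cvg_ex[l Dl].
have fp := p_comp (frac_intF_cvg0 xi_gt0 (ltnW iln)).
have pw : (p x `^ (1 - xi)) @[x --> E] --> 0.
  by apply: (@p_comp (fun s => s `^ (1 - xi))); apply: powR_cvg0; rewrite subr_gt0.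
(* The second factor is the inverse of [kern xi (p x)] and tends to 0 because xi < 1. The product is
   therefore constantly k and tends to 0. *)
have k_cvg : ((D i x - frac_int xi (F i) (p x)) * (p x `^ (1 - xi) * Gamma xi))
    @[x --> E] --> (0 : R).
  rewrite -[X in _ --> X](mulr0 (l - 0)) -[X in _ * X](mul0r (Gamma xi)).
  apply: cvgM; first exact: cvgB.
  by apply: cvgM => //; exact: cvg_cst.
suff : (fun _ : R => k) @ E --> (0 : R).
  by move/(cvg_lim (@Rhausdorff R)) => <-; rewrite lim_cst.
move: k_cvg; apply: cvg_trans; apply: near_eq_cvg; apply: filterS E_itv => x xab.
have /andP[px0 _] := p_itv xab.
rewrite DE// addrK kern_gt0E//.
have -> : p x `^ (1 - xi) = (p x `^ (xi - 1))^-1 by rewrite -powRN opprB.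
have := powR_gt0 (xi - 1) px0; have := Gamma_gt0 xi_gt0.
move: (Gamma xi) (p x `^ (xi - 1)) => G w G0 w0.
by field; rewrite !gt_eqF.
Qed.

(** The closed form of D_i is needed to differentiate it, and only the limit of D_(i+1) reveals that
    c_i = 0; the induction carries both facts. It stops short of c_(n-1), as no limit of D_n is
    assumed. *)
Let coef_eq0 : 0 < xi -> forall i, (i < n)%N -> (forall j, (j < i)%N -> c j = 0) /\
  (forall x, a < x < b -> D i x = frac_int xi (F i) (p x)).
Proof.
move=> xi_gt0; elim=> [_|i IH iln]; first by split => //; exact: D0.
have [cj Di] := IH (ltnW iln).
have iln' := ltnW iln.
have := DS iln' Di (fun s sL => is_derive_frac_intF causalF continuousF primF xi0 iln' sL).
rewrite gt_eqF// => DSi.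
have ci : c i = 0 by apply: sing_cvg iln DSi.
split; first by move=> j; rewrite ltnS leq_eqVlt => /predU1P[->//|]; exact: cj.
by move=> x xab; rewrite DSi// ci mul0r add0r.
Qed.

(** [W] is D_n read in the coordinate s. Continuity on ]0, L[ and vanishing for s <= 0 are what the
    passage from psi-fractional integrals to [frac_int] demands of an integrand; the orders m1 and
    m2 stay apart because that passage is made twice. The last clause serves the limits at the
    endpoints. *)
Lemma chart_taylor : exists W : R -> R,
  [/\ forall x, a < x < b -> D n x = W (p x),
    forall m s, 0 <= m -> 0 < s < L -> {for s, continuous (frac_int m W)},
    forall m s, 0 <= m -> s <= 0 -> frac_int m W s = 0,
    forall m1 m2 x, 0 <= m1 -> 0 <= m2 -> m1 + m2 = n%:R - xi -> a < x < b ->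
      frac_int m1 (frac_int m2 W) (p x) = F 0%N (p x) -
        \sum_(1 <= k < n.+1) kern (n%:R - xi - k%:R + 1) (p x) *
          lim (D (n - k)%N x @[x --> E]) &
    0 < xi -> forall i, (i < n)%N -> lim (D i x @[x --> E]) = 0].
Proof.
have cF := causalF (leqnn n).
have contF m s : 0 <= m -> 0 < s < L -> {for s, continuous (frac_int m (F n))}.
  move=> m0 sL; apply: (continuous_frac_int (L := L)) => // t.
  exact: continuousF.
have [xi_eq0|xi_neq0] := eqVneq xi 0.
  have DE i : (i <= n)%N -> forall x, a < x < b -> D i x = F i (p x).
    elim: i => [_ x xab|i IH iln]; first by rewrite D0// xi_eq0 frac_int0.
    apply: (DS iln (IH (ltnW iln))) => s sL.
    have := is_derive_frac_intF causalF continuousF primF (lexx 0) iln sL.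
    by rewrite eqxx mul0r add0r !frac_int0.
  have limD i : (i < n)%N -> lim (D i x @[x --> E]) = c i.
    move=> iln; apply/cvg_lim => //; apply: (D_lim (DE i (ltnW iln))).
    have : c i + frac_int 1 (F i.+1) s @[s --> 0^'+] --> c i + 0.
      by apply: cvgD; [exact: cvg_cst|exact: frac_intF_cvg0].
    rewrite addr0; apply: cvg_trans; apply: near_eq_cvg; near=> s.
    rewrite primF//; apply/andP; split => //; near: s; apply: nbhs_right_lt.
  exists (F n); split => [|//| | |]; [exact: DE| | |by rewrite xi_eq0 ltxx].
    by move=> m s m0 s0; have [_ -> ] := causal_frac_int m0 cF.
  move=> m1 m2 x m10 m20 m12 xab; rewrite frac_intA// m12 xi_eq0 subr0.
  rewrite (fractional_taylor causalF primF (leqnn n) (p_itv xab)).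
  (* Reindexing by j = n - k: the kernel order n - k + 1 is j + 1, and the limit of D_j is c_j. *)
  have -> : \sum_(1 <= k < n.+1) kern (n%:R - k%:R + 1) (p x) *
      lim (D (n - k)%N x @[x --> E]) = \sum_(0 <= j < n) c j * kern j.+1%:R (p x).
    rewrite big_add1/= [RHS]big_nat_rev/=; apply: eq_big_nat => i /andP[_ iln].
    have lt : (n - i.+1 < n)%N by rewrite ltn_subrL n_gt0.
    have nE : (n - i.+1).+1%:R = n%:R - i.+1%:R + 1 :> R by rewrite -[LHS]natr1 natrB.
    by rewrite add0n (limD _ lt) nE mulrC.
  by rewrite addrAC subrr add0r.
have xi_gt0 : 0 < xi by rewrite lt_neqAle eq_sym xi_neq0.
have limD i : (i < n)%N -> lim (D i x @[x --> E]) = 0.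
  move=> iln; apply/cvg_lim => //; have [_ DE] := coef_eq0 xi_gt0 iln.
  by apply: (D_lim DE); exact: frac_intF_cvg0 (ltnW iln).
have n1 : (n.-1 < n)%N by rewrite prednK.
have [cj Dn1] := coef_eq0 xi_gt0 n1.
have W_E m : 0 <= m ->
    frac_int m (sing_part (c n.-1) xi (F n)) = sing_part (c n.-1) (m + xi) (F n).
  by move=> m0; apply/funext => s; exact: frac_int_sing_part.
(* The n-th derivative may keep the singular term with coefficient c_(n-1). It is then unbounded
   near 0, so [frac_int_sing_part] has to replace [frac_intA]. *)
exists (sing_part (c n.-1) xi (F n)); split.
- move=> x xab; rewrite -{1}(prednK n_gt0).
  have := DS n1 Dn1 (fun s sL =>
    is_derive_frac_intF causalF continuousF primF xi0 n1 sL).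
  by rewrite gt_eqF// prednK// => ->.
- move=> m s m0 sL; rewrite W_E//; have /andP[s0 _] := sL.
  apply: cvgD; last by apply: contF => //; rewrite addr_ge0.
  by apply: cvgM; [exact: cvg_cst|exact: continuous_kern].
- move=> m s m0 s0; rewrite W_E// /sing_part kern_le0// mulr0 add0r.
  by have [_ -> ] := causal_frac_int (addr_ge0 m0 xi0) cF.
- move=> m1 m2 x m10 m20 m12 xab; rewrite W_E// frac_int_sing_part//; last first.
    by rewrite ltr_wpDl.
  rewrite addrA m12 subrK big_nat_cond big1 ?subr0; last first.
    move=> k /andP[/andP[k0 kn] _]; rewrite limD ?mulr0//.
    by rewrite -{2}(subn0 n) ltn_sub2l.
  rewrite (fractional_taylor causalF primF (leqnn n) (p_itv xab)).
  have : \sum_(0 <= j < n.-1.+1) c j * kern j.+1%:R (p x) = c n.-1 * kern n.-1.+1%:R (p x).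
    rewrite big_nat_recr//= big_nat_cond big1 ?add0r//.
    by move=> j /andP[/andP[_ jn] _]; rewrite cj// mul0r.
  by rewrite (prednK n_gt0) => ->.
- by move=> _; exact: limD.
Unshelve. all: by end_near. Qed.

End chart.

(** * Substitution by psi *)

Section substitution.
Context {R : realType}.
Notation mu := (@lebesgue_measure R).
Variables (q : R -> R) (a b : R).
Hypothesis ab : a < b.
Hypothesis q_incr : {in `[a, b]%R &, {homo q : x y / x < y}}.
Hypothesis q_cont : {within `[a, b], continuous q}.
Hypothesis q_der : forall x, a < x < b -> derivable q x 1.
Hypothesis q'_cont : forall x, a < x < b -> {for x, continuous (derive1 q)}.
Hypothesis q'_ge0 : forall x, a < x < b -> 0 <= derive1 q x.

(** Endpoints of compact intervals exhausting ]a, b[. The shift, at most a third of the length,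
    keeps [an n < bn n] for every n. *)
Let an n : R := a + (b - a) / n.+3%:R.
Let bn n : R := b - (b - a) / n.+3%:R.

Let gap n : 0 < (b - a) / n.+3%:R < (b - a) / 2.
Proof.
have ba : 0 < b - a by rewrite subr_gt0.
rewrite divr_gt0//= ltr_pM2l// ltf_pV2 ?posrE// ltr_nat.
by [].
Qed.

Let anbn n : [/\ a < an n, an n < bn n & bn n < b].
Proof.
by have /andP[] := gap n; rewrite /an /bn; move: (_ / n.+3%:R) => e h1 h2; split; lra.
Qed.

Let itv_nd : nondecreasing_seq (fun n => `[an n, bn n]%classic : set R).
Proof.
move=> m n mn; apply/subsetPset => x /=; rewrite !in_itv/= /an /bn.
have : (b - a) / n.+3%:R <= (b - a) / m.+3%:R.
  by rewrite ler_pM2l ?subr_gt0// lef_pV2 ?posrE// ler_nat.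
by move: (_ / n.+3%:R) (_ / m.+3%:R) => e1 e2; lra.
Qed.

Let itvE : \bigcup_n `[an n, bn n]%classic = `]a, b[%classic.
Proof.
apply/seteqP; split => [x [n _] /=|x /=]; rewrite !in_itv/=.
  by have [] := anbn n; lra.
move=> /andP[ax xb].
pose e := Num.min (x - a) (b - x).
have e0 : 0 < e by rewrite lt_min !subr_gt0 ax.
pose n := Num.truncn ((b - a) / e).
have ne : (b - a) / n.+3%:R <= e.
  rewrite ler_pdivrMr// mulrC -ler_pdivrMr//.
  by apply/ltW/(lt_le_trans (truncnS_gt _)); rewrite ler_nat; exact: leqW (leqnSn _).
have /andP[e1 e2] : (e <= x - a) && (e <= b - x) by rewrite -le_min.
by exists n => //=; rewrite in_itv/= /an /bn; move: ne; move: (_ / n.+3%:R) => u; lra.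
Qed.

Let lt_q x y : a <= x -> x < y -> y <= b -> q x < q y.
Proof.
by move=> ax xy yb; apply: q_incr => //; rewrite in_itv/=; lra.
Qed.

Let le_q x y : a <= x -> x <= y -> y <= b -> q x <= q y.
Proof.
by move=> ax; rewrite le_eqVlt => /predU1P[->//|xy] yb; exact/ltW/lt_q.
Qed.

Let qitv_nd : nondecreasing_seq (fun n => `[q (an n), q (bn n)]%classic : set R).
Proof.
move=> m n mn; apply/subsetPset => x /=; rewrite !in_itv/= => /andP[mx xm].
have [a1 a2 a3] := anbn n; have [b1 b2 b3] := anbn m.
have /subsetPset sub := itv_nd mn.
have /sub : `[an m, bn m]%classic (an m) by rewrite /= in_itv/= lexx ltW.
rewrite /= in_itv/= => /andP[h1 _].
have /sub : `[an m, bn m]%classic (bn m) by rewrite /= in_itv/= lexx ltW.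
rewrite /= in_itv/= => /andP[_ h2].
apply/andP; split.
  by apply: le_trans mx; apply: le_q => //; lra.
by apply: (le_trans xm); apply: le_q => //; lra.
Qed.

Let qitvE : \bigcup_n `[q (an n), q (bn n)]%classic = `]q a, q b[%classic.
Proof.
apply/seteqP; split => [x [n _] /=|y /=]; rewrite !in_itv/= => /andP[h1 h2].
  have [a1 a2 a3] := anbn n; apply/andP; split.
    by apply: lt_le_trans h1; apply: lt_q => //; lra.
  by apply: (le_lt_trans h2); apply: lt_q => //; lra.
have qab := lt_q (lexx a) ab (lexx b).
have [x xab xy] : exists2 x, x \in `[a, b]%R & q x = y.
  by apply: IVT => //; [exact: ltW|rewrite min_l ?max_r ?ltW//; lra].
have xab' : a < x < b.
  move: xab h1 h2; rewrite in_itv/= -xy => /andP[ax xb] h1 h2.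
  apply/andP; split; rewrite lt_neqAle ?ax ?xb andbT; apply/eqP => E.
    by move: h1; rewrite E ltxx.
  by move: h2; rewrite E ltxx.
have : `]a, b[%classic x by rewrite /= in_itv.
rewrite -itvE => -[n _]; rewrite /= in_itv/= => /andP[ax xb].
have [a1 a2 a3] := anbn n.
exists n => //=; rewrite in_itv/= -xy; apply/andP; split; apply: le_q => //; lra.
Qed.

(** [G] will contain a power that may blow up at an end of the interval. Substitution is done on
    compact subintervals, and monotone convergence passes to the limit, infinite values included. *)
Lemma ge0_integral_substitution_oo (G : R -> R) :
  (forall y, q a < y < q b -> {for y, continuous G}) ->
  (forall y, q a < y < q b -> 0 <= G y) ->
  (\int[mu]_(y in `]q a, q b[) (G y)%:E =
   \int[mu]_(x in `]a, b[) (derive1 q x * G (q x))%:E)%E.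
Proof.
move=> cG G0; rewrite -itvE -qitvE.
have subn n x : `[an n, bn n]%classic x -> a < x < b.
  move=> xn; have : (\bigcup_n `[an n, bn n]%classic) x by exists n.
  by rewrite itvE /= in_itv.
have qsubn n x : `[q (an n), q (bn n)]%classic x -> q a < x < q b.
  move=> xn; have : (\bigcup_n `[q (an n), q (bn n)]%classic) x by exists n.
  by rewrite qitvE /= in_itv.
have qab x : a < x < b -> q a < q x < q b.
  by move=> /andP[ax xb]; rewrite !lt_q// ltW.
have cq x : a < x < b -> {for x, continuous q}.
  by move=> /q_der dq; apply: differentiable_continuous; apply/derivable1_diffP.
have cqG x : a < x < b -> {for x, continuous (fun x => derive1 q x * G (q x))}.
  move=> xab; apply: cvgM; first exact: q'_cont.
  apply: (@cvg_comp _ _ _ q G _ (nbhs (q x))); first exact: cq.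
  exact/cG/qab.
have cG' n : {within `[q (an n), q (bn n)], continuous G}.
  by apply: continuous_in_subspaceT => y; rewrite inE => /qsubn; exact: cG.
have cqG' n : {within `[an n, bn n], continuous (fun x => derive1 q x * G (q x))}.
  by apply: continuous_in_subspaceT => y; rewrite inE => /subn; exact: cqG.
have l1 : (\int[mu]_(y in `[q (an n), q (bn n)]) (G y)%:E)%E @[n --> \oo] -->
    (\int[mu]_(y in \bigcup_n `[q (an n), q (bn n)]%classic) (G y)%:E)%E.
  apply: (@ge0_nondecreasing_set_cvg_integral _ (measurableTypeR R) R) => //.
  - by move=> n; apply/measurable_EFinP; exact: subspace_continuous_measurable_fun.
  - by move=> n y /qsubn yab; rewrite lee_fin G0.
have l2 : (\int[mu]_(x in `[an n, bn n]) (derive1 q x * G (q x))%:E)%E @[n --> \oo] -->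
    (\int[mu]_(x in \bigcup_n `[an n, bn n]%classic) (derive1 q x * G (q x))%:E)%E.
  apply: (@ge0_nondecreasing_set_cvg_integral _ (measurableTypeR R) R) => //.
  - by move=> n; apply/measurable_EFinP; exact: subspace_continuous_measurable_fun.
  - by move=> n x /subn xab; rewrite lee_fin mulr_ge0 ?q'_ge0 ?G0 ?qab.
have E12 n : (\int[mu]_(y in `[q (an n), q (bn n)]) (G y)%:E =
    \int[mu]_(x in `[an n, bn n]) (derive1 q x * G (q x))%:E)%E.
  have [a1 a2 a3] := anbn n.
  rewrite (@integration_by_substitution_increasing _ q)//.
  - by apply: eq_integral => x _ /=; rewrite mulrC.
  - exact: ltW.
  - by move=> x y; rewrite !in_itv/= => xn yn xy; apply: lt_q => //; lra.
  - by move=> x; rewrite in_itv/= => xn; apply: q'_cont; lra.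
  - by apply/cvg_ex; exists (derive1 q (an n)); apply: cvg_at_right_filter;
      apply: q'_cont; lra.
  - by apply/cvg_ex; exists (derive1 q (bn n)); apply: cvg_at_left_filter;
      apply: q'_cont; lra.
  - split.
    + by move=> x; rewrite in_itv/= => xn; apply: q_der; lra.
    + by apply: cvg_at_right_filter; apply: cq; lra.
    + by apply: cvg_at_left_filter; apply: cq; lra.
rewrite (funext E12) in l1.
exact: (cvg_unique _ l1 l2).
Qed.

(** Positive and negative parts are substituted separately, since q' >= 0 passes through the maximum
    with 0. The function [u] is prescribed only inside ]a, b[ because [derive1 q] is meaningless at
    the ends. *)
Lemma Rintegral_substitution_oo (G u : R -> R) :
  (forall y, q a < y < q b -> {for y, continuous G}) ->
  (forall x, a < x < b -> u x = derive1 q x * G (q x)) ->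
  \int[mu]_(x in `[a, b]) u x = \int[mu]_(y in `]q a, q b[) G y.
Proof.
move=> cG uE.
have qab x : a < x < b -> q a < q x < q b.
  by move=> /andP[ax xb]; rewrite !lt_q// ltW.
have cq x : a < x < b -> {for x, continuous q}.
  by move=> /q_der dq; apply: differentiable_continuous; apply/derivable1_diffP.
have cqG x : a < x < b -> {for x, continuous (fun x => derive1 q x * G (q x))}.
  move=> xab; apply: cvgM; first exact: q'_cont.
  apply: (@cvg_comp _ _ _ q G _ (nbhs (q x))); first exact: cq.
  exact/cG/qab.
transitivity (\int[mu]_(x in `]a, b[) (derive1 q x * G (q x))).
  have uE' : {in `]a, b[%classic, (fun x => derive1 q x * G (q x)) =1 u}.
    by move=> x; rewrite inE/= in_itv/= => xab; rewrite uE.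
  transitivity (\int[mu]_(x in `]a, b[) u x); last first.
    by apply: eq_Rintegral => x xab; rewrite uE'.
  rewrite /Rintegral; congr fine; apply: integral_itv_bndoo.
  apply/measurable_EFinP; apply: eq_measurable_fun uE' _.
  apply: open_continuous_measurable_fun => //.
  by move=> x; rewrite inE/= in_itv/=; exact: cqG.
rewrite !Rintegral_ge0_split; congr (fine (_ - _)); apply/esym.
  rewrite ge0_integral_substitution_oo.
  - apply: eq_integral => x; rewrite inE/= in_itv/= => xab.
    by rewrite maxr_pMr ?mulr0// q'_ge0.
  - by move=> y yab; apply: continuous_max; [exact: cG|exact: cvg_cst].
  - by move=> y _; rewrite le_max lexx orbT.
rewrite ge0_integral_substitution_oo.
- apply: eq_integral => x; rewrite inE/= in_itv/= => xab.
  by rewrite -mulrN maxr_pMr ?mulr0// q'_ge0.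
- by move=> y yab; apply: continuous_max; [apply: cvgN; exact: cG|exact: cvg_cst].
- by move=> y _; rewrite le_max lexx orbT.
Qed.

End substitution.

(** * From psi-fractional integrals to convolutions *)

Section transfer.
Context {R : realType}.
Notation mu := (@lebesgue_measure R).
Variables (psi : R -> R) (a b : R).
Hypothesis psi_incr : {in `[a, b]%R &, {homo psi : x y / x < y}}.
Hypothesis psi_cont : {within `[a, b], continuous psi}.
Hypothesis psi_der : forall x, a < x < b -> derivable psi x 1.
Hypothesis psi'_cont : forall x, a < x < b -> {for x, continuous (derive1 psi)}.
Hypothesis psi'_ge0 : forall x, a < x < b -> 0 <= derive1 psi x.

Let within_sub (c d : R) : a <= c -> c < d -> d <= b ->
  {within `[c, d], continuous psi}.
Proof.
move=> ac cd db; apply: continuous_subspaceW psi_cont => x /=.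
by rewrite !in_itv/=; lra.
Qed.

Let incr_sub (c d : R) : a <= c -> d <= b ->
  {in `[c, d]%R &, {homo psi : x y / x < y}}.
Proof. by move=> ac db x y; rewrite !in_itv/= => xcd ycd; apply: psi_incr; rewrite in_itv/=; lra. Qed.

Let ltpsi x y : a <= x -> x < y -> y <= b -> psi x < psi y.
Proof. by move=> ax xy yb; apply: psi_incr => //; rewrite in_itv/=; lra. Qed.

Lemma measurable_cutoff (L : R) (H : R -> R) :
  (forall s, 0 < s < L -> {for s, continuous H}) -> measurable_fun setT (H \_ `]0, L[).
Proof.
move=> cH; apply/(measurable_restrictT H) => //.
apply: open_continuous_measurable_fun => //.
by move=> s; rewrite inE/= in_itv/=; exact: cH.
Qed.

(** Beyond s nothing is known of [H], not even measurability. The cutoff to ]0, s[ leaves the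
    integrand unchanged and supplies the measurable function on the line that [Rintegral_affine]
    requires. *)
Let frac_int_oo m (H : R -> R) (s : R) : 0 < m -> (forall r, r <= 0 -> H r = 0) ->
  (forall r, 0 < r < s -> {for r, continuous H}) ->
  exists f, [/\ measurable_fun setT f,
    frac_int m H s = (Gamma m)^-1 * \int[mu]_r f r,
    forall r, 0 < r < s -> f r = (s - r) `^ (m - 1) * H r &
    forall r, ~~ (0 < r < s) -> f r = 0].
Proof.
move=> m0 H0 cH.
exists ((fun r => (s - r) `^ (m - 1) * H r) \_ `]0, s[).
have mf : measurable_fun setT ((fun r => (s - r) `^ (m - 1) * H r) \_ `]0, s[).
  apply: measurable_cutoff => r rs; apply: cvgM; last exact: cH.
  apply: (@cvg_comp _ _ _ (fun r => s - r) (fun u => u `^ (m - 1)) _ (nbhs (s - r))).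
    by apply: cvgB; [exact: cvg_cst|exact: cvg_id].
  by apply: is_derive1_continuous (is_derive1_powR _ _); rewrite subr_gt0; case/andP: rs.
split => //.
- rewrite frac_int_gt0// -gt0_RintegralZl ?invr_gt0 ?Gamma_gt0//.
  apply: eq_Rintegral => r _; rewrite patchE.
  case: ifPn; rewrite ?notin_setE ?inE/= in_itv/=.
    by move=> /andP[r0 rs]; rewrite kern_gt0E ?subr_gt0// mulrA; congr (_ * _); rewrite mulrC.
  move=> /negP; rewrite negb_and -!leNgt mulr0 => /orP[r0|rs]; first by rewrite H0// mulr0.
  by rewrite kern_le0 ?subr_le0// mul0r.
- by move=> r rs; rewrite patchE mem_set//= in_itv.
- by move=> r rs; rewrite patchE memNset//= in_itv/=; apply/negP.
Qed.

(** Both integrals are brought to the variable v in ]psi a, psi x[: one by v = psi t, the other by v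
    = psi a + r. *)
Lemma fint_leftE m (h H : R -> R) : 0 <= m ->
  (forall s, 0 < s < psi b - psi a -> {for s, continuous H}) ->
  (forall s, s <= 0 -> H s = 0) ->
  (forall x, a < x < b -> h x = H (psi x - psi a)) ->
  forall x, a < x < b -> fint_left psi a m h x = frac_int m H (psi x - psi a).
Proof.
rewrite le_eqVlt => /predU1P[<-|m0] cH H0 hH x xab.
  by rewrite /fint_left eqxx frac_int0 hH.
have /andP[ax xb] := xab.
have xb' := ltpsi (ltW ax) xb (lexx b).
have ax' := ltpsi (lexx a) ax (ltW xb).
have cH' r : 0 < r < psi x - psi a -> {for r, continuous H} by move=> rs; apply: cH; lra.
have [f [mf -> fE f0]] := frac_int_oo m0 H0 cH'.
rewrite /fint_left gt_eqF//; congr (_ * _).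
rewrite (@Rintegral_affine _ (- psi a) 1)// normr1 mul1r.
pose G v := (psi x - v) `^ (m - 1) * H (v - psi a).
transitivity (\int[mu]_(v in `]psi a, psi x[) G v).
  apply: (@Rintegral_substitution_oo _ psi a x ax).
  - by apply: incr_sub => //; exact: ltW.
  - by apply: within_sub => //; exact: ltW.
  - by move=> t ?; apply: psi_der; lra.
  - by move=> t ?; apply: psi'_cont; lra.
  - by move=> t ?; apply: psi'_ge0; lra.
  - move=> v vx; apply: cvgM.
      apply: (@cvg_comp _ _ _ (fun v => psi x - v) (fun u => u `^ (m - 1)) _
        (nbhs (psi x - v))).
        by apply: cvgB; [exact: cvg_cst|exact: cvg_id].
      by apply: is_derive1_continuous (is_derive1_powR _ _); lra.
    apply: (@cvg_comp _ _ _ (fun v => v - psi a) H _ (nbhs (v - psi a))).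
      by apply: cvgB; [exact: cvg_id|exact: cvg_cst].
    by apply: cH'; lra.
  - by move=> t tx; rewrite hH ?mulrA//; lra.
rewrite Rintegral_mkcond; apply: eq_Rintegral => v _; rewrite patchE mul1r.
case: ifPn; rewrite ?notin_setE ?inE/= in_itv/= => vs.
  by rewrite fE /G; [congr (_ `^ _ * H _); ring|lra].
by rewrite f0//; apply/negP => h'; apply: vs; lra.
Qed.

(** Here the second change of variable is the reflection v = psi b - r, the reason for allowing a
    negative slope in the affine substitution. *)
Lemma fint_rightE m (h H : R -> R) : 0 <= m ->
  (forall s, 0 < s < psi b - psi a -> {for s, continuous H}) ->
  (forall s, s <= 0 -> H s = 0) ->
  (forall x, a < x < b -> h x = H (psi b - psi x)) ->
  forall x, a < x < b -> fint_right psi b m h x = frac_int m H (psi b - psi x).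
Proof.
rewrite le_eqVlt => /predU1P[<-|m0] cH H0 hH x xab.
  by rewrite /fint_right eqxx frac_int0 hH.
have /andP[ax xb] := xab.
have xb' := ltpsi (ltW ax) xb (lexx b).
have ax' := ltpsi (lexx a) ax (ltW xb).
have cH' r : 0 < r < psi b - psi x -> {for r, continuous H} by move=> rs; apply: cH; lra.
have [f [mf -> fE f0]] := frac_int_oo m0 H0 cH'.
rewrite /fint_right gt_eqF//; congr (_ * _).
rewrite (@Rintegral_affine _ (psi b) (-1))// normrN1 mul1r.
pose G v := (v - psi x) `^ (m - 1) * H (psi b - v).
transitivity (\int[mu]_(v in `]psi x, psi b[) G v).
  apply: (@Rintegral_substitution_oo _ psi x b xb).
  - by apply: incr_sub => //; exact: ltW.
  - by apply: within_sub => //; exact: ltW.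
  - by move=> t ?; apply: psi_der; lra.
  - by move=> t ?; apply: psi'_cont; lra.
  - by move=> t ?; apply: psi'_ge0; lra.
  - move=> v vx; apply: cvgM.
      apply: (@cvg_comp _ _ _ (fun v => v - psi x) (fun u => u `^ (m - 1)) _
        (nbhs (v - psi x))).
        by apply: cvgB; [exact: cvg_id|exact: cvg_cst].
      by apply: is_derive1_continuous (is_derive1_powR _ _); lra.
    apply: (@cvg_comp _ _ _ (fun v => psi b - v) H _ (nbhs (psi b - v))).
      by apply: cvgB; [exact: cvg_cst|exact: cvg_id].
    by apply: cH'; lra.
  - by move=> t tx; rewrite hH ?mulrA//; lra.
rewrite Rintegral_mkcond; apply: eq_Rintegral => v _; rewrite patchE mulN1r.
case: ifPn; rewrite ?notin_setE ?inE/= in_itv/= => vs.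
  by rewrite fE /G; [congr (_ `^ _ * H _); ring|lra].
by rewrite f0//; apply/negP => h'; apply: vs; lra.
Qed.

End transfer.

(** * Functions of class C^n up to the endpoints *)

Section smooth_class.
Context {R : realType}.
Variables a b : R.
Hypothesis ab : a < b.
Implicit Types (f g : R -> R) (m : nat).

Definition has_lims g := exists l r, g x @[x --> a^'+] --> (l : R) /\ g x @[x --> b^'-] --> (r : R).

(** No value at a or b is mentioned, so the class depends on g inside ]a, b[ only, and the recursion
    on the derivative gives closure under products and inverses by induction. *)
Fixpoint smooth m g : Prop :=
  [/\ forall x, a < x < b -> {for x, continuous g}, has_lims g &
    if m is m'.+1 then (forall x, a < x < b -> derivable g x 1) /\ smooth m' (derive1 g)
    else True].

Lemma near_itv_right : \forall x \near a^'+, a < x < b.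
Proof.
by near=> x; apply/andP; split.
Unshelve. all: by end_near. Qed.

Lemma near_itv_left : \forall x \near b^'-, a < x < b.
Proof.
by near=> x; apply/andP; split.
Unshelve. all: by end_near. Qed.

Lemma eq_has_lims f g : (forall x, a < x < b -> f x = g x) -> has_lims f -> has_lims g.
Proof.
move=> fg [l [r [fl fr]]]; exists l, r; split.
- move: fl; apply: cvg_trans; apply: near_eq_cvg.
  by apply: filterS near_itv_right => x /fg.
- move: fr; apply: cvg_trans; apply: near_eq_cvg.
  by apply: filterS near_itv_left => x /fg.
Qed.

Lemma near_eq_itvoo f g x : (forall x, a < x < b -> f x = g x) -> a < x < b ->
  \forall t \near x, f t = g t.
Proof. by move=> fg xab; apply: filterS (near_itvoo xab) => t /fg. Qed.

Lemma eq_derive1_itv f g : (forall x, a < x < b -> f x = g x) ->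
  forall x, a < x < b -> derive1 f x = derive1 g x.
Proof.
move=> fg x xab; rewrite !derive1E; apply: near_eq_derive.
exact: near_eq_itvoo fg xab.
Qed.

Lemma eq_smooth m f g : (forall x, a < x < b -> f x = g x) -> smooth m f -> smooth m g.
Proof.
elim: m f g => [|m IH] f g fg [cf lf df]; split.
- move=> x xab; have := cf x xab; rewrite /prop_for /continuous_at fg//.
  by apply: cvg_trans; apply: near_eq_cvg; exact: near_eq_itvoo fg xab.
- exact: eq_has_lims lf.
- by [].
- move=> x xab; have := cf x xab; rewrite /prop_for /continuous_at fg//.
  by apply: cvg_trans; apply: near_eq_cvg; exact: near_eq_itvoo fg xab.
- exact: eq_has_lims lf.
- have [d df'] := df; split.
    move=> x xab; apply: near_eq_derivable (d x xab).
    exact: near_eq_itvoo fg xab.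
  by apply: IH df'; exact: eq_derive1_itv.
Qed.

Lemma smoothS m f : smooth m.+1 f -> smooth m f.
Proof. by elim: m f => [|m IH] f [cf lf [df sf]]; split => //; split => //; exact: IH. Qed.

Lemma smooth_le m k f : (k <= m)%N -> smooth m f -> smooth k f.
Proof.
elim: m => [|m IH]; first by rewrite leqn0 => /eqP ->.
by rewrite leq_eqVlt => /predU1P[->//|km] /smoothS; exact: IH.
Qed.

Lemma smooth_cst m (k : R) : smooth m (fun=> k).
Proof.
elim: m k => [|m IH] k; split => //.
- by move=> x _; exact: cvg_cst.
- by exists k, k; split; exact: cvg_cst.
- by move=> x _; exact: cvg_cst.
- by exists k, k; split; exact: cvg_cst.
- split=> [x _|]; first exact: derivable_cst.
  by apply: (eq_smooth (f := fun=> 0)) => // x _; rewrite derive1_cst.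
Qed.

Lemma has_limsD f g : has_lims f -> has_lims g -> has_lims (fun x => f x + g x).
Proof.
move=> [l [r [fl fr]]] [l' [r' [gl gr]]]; exists (l + l'), (r + r').
by split; exact: cvgD.
Qed.

Lemma has_limsM f g : has_lims f -> has_lims g -> has_lims (fun x => f x * g x).
Proof.
move=> [l [r [fl fr]]] [l' [r' [gl gr]]]; exists (l * l'), (r * r').
by split; exact: cvgM.
Qed.

Lemma smoothD m f g : smooth m f -> smooth m g -> smooth m (fun x => f x + g x).
Proof.
elim: m f g => [|m IH] f g [cf lf df] [cg lg dg]; split => //.
- by move=> x xab; apply: cvgD; [exact: cf|exact: cg].
- exact: has_limsD.
- by move=> x xab; apply: cvgD; [exact: cf|exact: cg].
- exact: has_limsD.
- have [[df0 df1] [dg0 dg1]] := (df, dg); split.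
    by move=> x xab; apply: derivableD; [exact: df0|exact: dg0].
  apply: eq_smooth (IH _ _ df1 dg1) => x xab.
  by rewrite !derive1E deriveD//; [exact: df0|exact: dg0].
Qed.

Lemma smoothM m f g : smooth m f -> smooth m g -> smooth m (fun x => f x * g x).
Proof.
elim: m f g => [|m IH] f g sf sg; have [[cf lf df] [cg lg dg]] := (sf, sg); split => //.
- by move=> x xab; apply: cvgM; [exact: cf|exact: cg].
- exact: has_limsM.
- by move=> x xab; apply: cvgM; [exact: cf|exact: cg].
- exact: has_limsM.
- have [[df0 df1] [dg0 dg1]] := (df, dg); split.
    by move=> x xab; apply: derivableM; [exact: df0|exact: dg0].
  apply: eq_smooth (smoothD (IH _ _ (smoothS sf) dg1) (IH _ _ (smoothS sg) df1)) => x xab.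
  by rewrite !derive1E deriveM//; [exact: df0|exact: dg0].
Qed.

(** Nonzero limits at the ends are included so that 1/g has finite limits there. *)
Definition nonvanishing g := (forall x, a < x < b -> g x != 0) /\
  exists l r, [/\ l != 0, r != 0, g x @[x --> a^'+] --> (l : R) & g x @[x --> b^'-] --> (r : R)].

Lemma smoothV m g : nonvanishing g -> smooth m g -> smooth m (fun x => (g x)^-1).
Proof.
move=> nv; have [g0 [l [r [l0 r0 gl gr]]]] := nv.
have lV : has_lims (fun x => (g x)^-1) by exists l^-1, r^-1; split; exact: cvgV.
elim: m => [|m IH] sg; have [cg _ dg] := sg; split => //.
- by move=> x xab; apply: cvgV; [exact: g0|exact: cg].
- by move=> x xab; apply: cvgV; [exact: g0|exact: cg].
- have [dg0 dg1] := dg.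
  (* The derivative of 1/g is arranged as a product of the constant -1, g' and two copies of 1/g, to
     which the induction hypothesis and [smoothM] apply. *)
  have dV x : a < x < b ->
      is_derive x 1 (fun x => (g x)^-1) (- 1 * (derive1 g x * ((g x)^-1 * (g x)^-1))).
    move=> xab; have dgx := derivableP (dg0 x xab).
    apply: is_derive_eq (is_deriveV (g0 x xab) dgx) _.
    by rewrite derive1E /GRing.scale/= -exprVn expr2; ring.
  split; first by move=> x /dV[].
  have sV := IH (smoothS sg).
  apply: eq_smooth (smoothM (smooth_cst m (- 1)) (smoothM dg1 (smoothM sV sV))) => x xab.
  by have [_ dE] := dV x xab; rewrite [RHS]derive1E dE.
Qed.

Lemma within_endval g : {within `[a, b], continuous (endval a b g)} <->
  (forall x, a < x < b -> {for x, continuous g}) /\ has_lims g.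
Proof.
have endvalE x : a < x < b -> endval a b g x = g x.
  by move=> /andP[ax xb]; rewrite /endval gt_eqF// lt_eqF.
rewrite continuous_within_itvP//; split.
  move=> [c l r]; split.
    move=> x xab; have xin : x \in `]a, b[%R by rewrite in_itv.
    have := c x xin; rewrite /prop_for /continuous_at endvalE//.
    by apply: cvg_trans; apply: near_eq_cvg; apply: near_eq_itvoo xab.
  by apply: (eq_has_lims endvalE); exists (endval a b g a), (endval a b g b).
move=> [c [l [r [gl gr]]]].
have la : endval a b g a = l by rewrite /endval eqxx; exact: cvg_lim.
have rb : endval a b g b = r by rewrite /endval gt_eqF// eqxx; exact: cvg_lim.
split; rewrite ?la ?rb.
- move=> x; rewrite in_itv/= => xab; have := c x xab.
  rewrite /prop_for /continuous_at endvalE//; apply: cvg_trans; apply: near_eq_cvg.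
  by apply: filterS (near_itvoo xab) => t /endvalE.
- move: gl; apply: cvg_trans; apply: near_eq_cvg.
  by apply: filterS near_itv_right => t /endvalE.
- move: gr; apply: cvg_trans; apply: near_eq_cvg.
  by apply: filterS near_itv_left => t /endvalE.
Qed.

Lemma Cn_on_smooth n f : Cn_on n a b f -> smooth n f.
Proof.
move=> [cf Cf].
have C0 k : (k <= n)%N -> (forall x, a < x < b -> {for x, continuous (derive1n k f)}) /\
    has_lims (derive1n k f).
  case: k => [_|k kn]; last first.
    by have [_ /within_endval] := Cf k kn.
  have [c l r] := (continuous_within_itvP f ab).1 cf; split.
    by move=> x xab; apply: c; rewrite in_itv.
  by exists (f a), (f b).
suff S m k : (k + m)%N = n -> smooth m (derive1n k f) by apply: (S n 0%N).
elim: m k => [|m IH] k kmn.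
  by have [c l] := C0 k (eq_leq (etrans (esym (addn0 k)) kmn)); split.
have kn : (k < n)%N by rewrite -kmn addnS ltnS leq_addr.
have [c l] := C0 k (ltnW kn); have [d _] := Cf k kn.
split => //; split; last by apply: (IH k.+1); rewrite addSnnS.
by move=> x xab; apply: d; rewrite inE/= in_itv.
Qed.

(** The extreme value theorem is applied to the continuous extension [endval a b g]. *)
Lemma smooth_bounded g : smooth 0 g -> exists2 M, 0 <= M & forall x, a < x < b -> `|g x| <= M.
Proof.
move=> [c l _]; have cg := (within_endval g).2 (conj c l).
have [u _ gu] := EVT_max (ltW ab) cg; have [v _ gv] := EVT_min (ltW ab) cg.
exists (`|endval a b g u| + `|endval a b g v|); first by rewrite addr_ge0.
move=> x xab; have xin : x \in `[a, b]%R by rewrite in_itv/=; lra.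
have xE : endval a b g x = g x.
  by case/andP: xab => ax xb; rewrite /endval gt_eqF// lt_eqF.
have := gu x xin; have := gv x xin; rewrite xE => h1 h2.
have := ler_norm (endval a b g u); have := ler_norm (- endval a b g v); rewrite normrN.
have := normr_ge0 (endval a b g u); have := normr_ge0 (endval a b g v).
by rewrite ler_norml; lra.
Qed.

Lemma eq_on_itv_of_derive0 g : (forall x, a < x < b -> is_derive x 1 g 0) ->
  forall x y, a < x < b -> a < y < b -> g x = g y.
Proof.
move=> dg x y; wlog xy : x y / x < y.
  move=> H xab yab; have [xy|yx|->//] := ltgtP x y; first exact: H.
  by apply/esym/H.
move=> xab yab.
have [c _ E] : exists2 c, c \in `]x, y[%R & g y - g x = 0 * (y - x).
  apply: (@MVT _ g (fun=> 0) x y xy).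
    by move=> t; rewrite in_itv/= => txy; apply: dg; lra.
  apply: continuous_in_subspaceT => t; rewrite inE/= in_itv/= => txy.
  by apply: is_derive1_continuous (dg t _); lra.
by apply/esym/eqP; rewrite -subr_eq0 E mul0r.
Qed.

End smooth_class.

(** * The formula at one endpoint *)

Section one_sided.
Context {R : realType}.
(* On the left, p x = psi x - psi a, sigma = 1 and E = a^'+; on the right,
   p x = psi b - psi x, sigma = -1 and E = b^'-.  phi is the inverse of p. *)
Variables (a b L sigma : R) (n : nat) (psi f p phi : R -> R).
Variables (E : set_system R) (fI : R -> (R -> R) -> R -> R).
Hypothesis ab : a < b.
Hypothesis n_gt0 : (0 < n)%N.
Hypothesis L_gt0 : 0 < L.
Hypothesis psi_smooth : smooth a b n psi.
Hypothesis psi'_neq0 : nonvanishing a b (derive1 psi).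
Hypothesis f_smooth : smooth a b n f.
Hypothesis sigmaM : sigma * sigma = 1.
Hypothesis E_filter : ProperFilter E.
Hypothesis E_itv : \forall x \near E, a < x < b.
Hypothesis E_lim : forall g, has_lims a b g -> cvg (g x @[x --> E]).
Hypothesis p_itv : forall x, a < x < b -> 0 < p x < L.
Hypothesis phi_itv : forall s, 0 < s < L -> a < phi s < b.
Hypothesis pK : forall x, a < x < b -> phi (p x) = x.
Hypothesis phiK : forall s, 0 < s < L -> p (phi s) = s.
Hypothesis phi_cont : forall s, 0 < s < L -> {for s, continuous phi}.
Hypothesis p_der : forall x, a < x < b -> is_derive x 1 p (sigma * derive1 psi x).
Hypothesis p_cvg : p x @[x --> E] --> 0^'+.
Hypothesis fIE : forall m (h H : R -> R), 0 <= m ->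
  (forall s, 0 < s < L -> {for s, continuous H}) -> (forall s, s <= 0 -> H s = 0) ->
  (forall x, a < x < b -> h x = H (p x)) ->
  forall x, a < x < b -> fI m h x = frac_int m H (p x).

(** Since p' = sigma psi' and sigma^2 = 1, this is d/ds in the coordinate s = p x at either
    endpoint. *)
Let T g x := sigma * dpsi psi g x.

Let smoothT m g : (m < n)%N -> smooth a b m.+1 g -> smooth a b m (T g).
Proof.
move=> mn [_ _ [_ sg]].
have [_ _ [_ sp]] : smooth a b m.+1 psi by exact: smooth_le psi_smooth.
exact: (eq_smooth ab _ (smoothM ab (smooth_cst ab m sigma) (smoothM ab (smoothV ab psi'_neq0 sp) sg))).
Qed.

Let u j := iter j T f.

Let smooth_u j : (j <= n)%N -> smooth a b (n - j) (u j).
Proof.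
elim: j => [_|j IH jn]; first by rewrite subn0.
apply: smoothT; first by rewrite ltn_subrL n_gt0.
by rewrite -subSn// subSS; exact: IH (ltnW jn).
Qed.

Let u_smooth0 j : (j <= n)%N -> smooth a b 0 (u j).
Proof. by move=> /smooth_u; exact: smooth_le. Qed.

Let psi'_neq x : a < x < b -> derive1 psi x != 0.
Proof. by have [h _] := psi'_neq0; exact: h. Qed.

Let u_der j x : (j < n)%N -> a < x < b ->
  is_derive x 1 (u j) (sigma * derive1 psi x * u j.+1 x).
Proof.
move=> jn xab; have : smooth a b (n - j) (u j) by exact: smooth_u (ltnW jn).
rewrite -(prednK (n := n - j)) ?subn_gt0// => -[_ _ [d _]].
apply: DeriveDef; first exact: d.
rewrite -derive1E /u iterS /T /dpsi.
have := psi'_neq xab; move: (derive1 psi x) (derive1 _ x) => k d0 k0.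
by rewrite mulrACA sigmaM mul1r mulrA divff// mul1r.
Qed.

Let c j : R := lim (u j x @[x --> E]).

(** Cutting off below 0 makes [F j] causal. Cutting off above L is harmless, as a fractional
    integral at s depends only on values at r <= s. *)
Let F j s : R := (u j \o phi) \_ `]0, L[ s.

Let FE j s : 0 < s < L -> F j s = u j (phi s).
Proof. by move=> sL; rewrite /F patchE mem_set//= in_itv. Qed.

Let F0 j s : s <= 0 -> F j s = 0.
Proof. by move=> s0; rewrite /F patchE memNset//= in_itv/=; apply/negP; rewrite negb_and -leNgt s0. Qed.

Let contu j s : (j <= n)%N -> 0 < s < L -> {for s, continuous (u j \o phi)}.
Proof.
move=> jn sL; apply: (@cvg_comp _ _ _ phi (u j) _ (nbhs (phi s))); first exact: phi_cont.
by have [cu _ _] := u_smooth0 jn; apply/cu/phi_itv.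
Qed.

Let continuousF j s : (j <= n)%N -> 0 < s < L -> {for s, continuous (F j)}.
Proof.
move=> jn sL; have := contu jn sL.
rewrite /prop_for /continuous_at /= -FE//; apply: cvg_trans; apply: near_eq_cvg.
by apply: filterS (near_itvoo sL) => t tL; rewrite FE.
Qed.

Let causalF j : (j <= n)%N -> causal (F j).
Proof.
move=> jn; split.
- by apply: measurable_cutoff => s sL; exact: contu.
- by move=> s; exact: F0.
- move=> U; have [M M0 uM] := smooth_bounded ab (u_smooth0 jn); exists M => // s _.
  rewrite /F patchE; case: ifPn; rewrite ?notin_setE ?inE/= in_itv/= ?normr0// => sL.
  exact/uM/phi_itv.
Qed.

Let FpE j x : a < x < b -> F j (p x) = u j x.
Proof. by move=> xab; rewrite FE ?pK// p_itv. Qed.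

Let p_comp (G : R -> R) (l : R) : G s @[s --> 0^'+] --> l -> G (p x) @[x --> E] --> l.
Proof. by move=> Gl; apply: (@cvg_comp _ _ _ p G E 0^'+). Qed.

(** In the variable x, the difference of u_j and the integral has derivative 0, and its constant
    value is found at the endpoint, where the integral tends to 0. Working in x avoids
    differentiating [phi], which is only known to be continuous. *)
Let primu j x : (j < n)%N -> a < x < b ->
  u j x = c j + frac_int 1 (F j.+1) (p x).
Proof.
move=> jn xab; rewrite frac_int_gt0//.
have [_ Z0 _] := causalF jn.
have dI t : a < t < b ->
    is_derive t 1 (convol 1 (F j.+1) \o p) (u j.+1 t * (sigma * derive1 psi t)).
  move=> tab; rewrite -FpE//; apply: is_derive1_comp; last exact: p_der.
  have [mF _ _] := causalF jn; have /andP[pt0 _] := p_itv tab.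
  apply: is_derive_convol1 => //; last by apply: continuousF => //; exact: p_itv.
  by move=> s; apply: causal_convolvable => //; exact: causalF.
pose g t : R := u j t - convol 1 (F j.+1) (p t).
have dg t : a < t < b -> is_derive t 1 g 0.
  move=> tab; apply: is_derive_eq (is_deriveB (u_der jn tab) (dI t tab)) _.
  by rewrite mulrC subrr.
have g_cst t : a < t < b -> g t = g x.
  by move=> tab; exact: (eq_on_itv_of_derive0 dg).
have gc : g t @[t --> E] --> c j.
  rewrite -[X in _ --> X]subr0; apply: cvgB.
    by apply: E_lim; have [] := u_smooth0 (ltnW jn).
  apply: p_comp; rewrite -(frac_int_gt0 (F j.+1) ltr01).
  by apply: cvg_frac_int0 => //; exact: causalF.
have gx : g t @[t --> E] --> g x.
  have : (fun _ : R => g x) @ E --> g x by exact: cvg_cst.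
  apply: cvg_trans; apply: near_eq_cvg.
  by apply: filterS E_itv => t tab; rewrite g_cst.
have <- : g x = c j by exact: (cvg_unique _ gx gc).
by rewrite /g subrK.
Qed.

Lemma one_sided_taylor (xi eta alpha : R) :
  0 <= xi < 1 -> 0 <= eta -> 0 <= alpha -> alpha + eta = n%:R - xi ->
  (forall i, (i < n)%N -> cvg (iter i T (fI xi f) x @[x --> E])) ->
  (forall x, a < x < b -> fI alpha (fI eta (iter n T (fI xi f))) x =
    f x - \sum_(1 <= k < n.+1) kern (n%:R - xi - k%:R + 1) (p x) *
      lim (iter (n - k)%N T (fI xi f) x @[x --> E])) /\
  (0 < xi -> forall i, (i < n)%N -> lim (iter i T (fI xi f) x @[x --> E]) = 0).
Proof.
move=> xi01 eta0 alpha0 sum_n D_cvg.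
have xi0 : 0 <= xi by case/andP: xi01.
have primF j s : (j < n)%N -> 0 < s < L -> F j s = c j + frac_int 1 (F j.+1) s.
  by move=> jn sL; rewrite (FE j sL) (primu jn (phi_itv sL)) (phiK sL).
pose D i := iter i T (fI xi f).
have D0 x : a < x < b -> D 0%N x = frac_int xi (F 0%N) (p x).
  move=> xab; apply: fIE => // [s sL|s s0|t tab].
  - exact: continuousF.
  - exact: F0.
  - by rewrite FpE.
have DS i (G G' : R -> R) : (i < n)%N -> (forall x, a < x < b -> D i x = G (p x)) ->
    (forall s, 0 < s < L -> is_derive s 1 G (G' s)) ->
    forall x, a < x < b -> D i.+1 x = G' (p x).
  move=> iltn DG dG x xab.
  have dGp := is_derive1_comp (dG _ (p_itv xab)) (p_der xab).
  have dD : is_derive x 1 (D i) (G' (p x) * (sigma * derive1 psi x)).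
    apply: near_eq_is_derive1 dGp.
    by apply: filterS (near_itvoo xab) => t tab; rewrite DG.
  have [_ dE] := dD.
  rewrite /D iterS /T /dpsi -/(D i) [derive1 (D i) x]derive1E dE.
  have := psi'_neq xab; move: (derive1 psi x) (G' (p x)) => k g k0.
  rewrite [X in sigma * X](_ : _ = sigma * g); last by field.
  by rewrite mulrA sigmaM mul1r.
have [W [DW contW W0 WE limD]] := chart_taylor E_filter L_gt0 xi01 n_gt0 causalF continuousF primF
  p_itv p_cvg E_itv D0 DS D_cvg.
(* At order 0 the clauses on [W] concern [W] itself; at order eta they serve the outer integral. *)
have fetaE x : a < x < b -> fI eta (D n) x = frac_int eta W (p x).
  move=> xab; apply: fIE => // [s sL|s s0].
  - by have := contW 0 s (lexx 0) sL; rewrite frac_int0.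
  - by have := W0 0 s (lexx 0) s0; rewrite frac_int0.
split => // x xab.
have -> : fI alpha (fI eta (D n)) x = frac_int alpha (frac_int eta W) (p x).
  apply: fIE => // [s sL|s s0]; first exact: contW.
  exact: W0.
by rewrite WE// FpE.
Qed.

End one_sided.

(** * Signs, limits at the endpoints and the inverse of psi *)

Section opposite.
Context {R : realType}.
Implicit Types (psi g : R -> R) (x : R).

(** Where g is not derivable both derivatives are the default value [point], which is 0. Thus signs
    can be moved through iterated derivatives whose existence is unknown. *)
Lemma derive1_opp g x : derive1 (fun y => - g y) x = - derive1 g x.
Proof.
have [dg|ndg] := pselect (derivable g x 1); first by rewrite !derive1E deriveN.
have ndNg : ~ derivable (fun y => - g y) x 1.
  move=> /derivableN; rewrite (_ : - _ = g)//.
  by apply/funext => y; rewrite [LHS]opprK.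
rewrite !derive1E /derive (dvgP ndg) (dvgP ndNg).
by rewrite [point](_ : _ = 0) ?oppr0.
Qed.

Lemma iter_dpsiN psi g j : iter j (fun g x => - dpsi psi g x) g =
  (fun x => (-1) ^+ j * iter j (dpsi psi) g x).
Proof.
elim: j => [|j IH]; first by apply/funext => x; rewrite mul1r.
rewrite iterS IH iterS; apply/funext => x; rewrite exprS /dpsi.
move: (iter j _ g) => G; rewrite -signr_odd.
case: (odd j) => /=.
- rewrite expr1 mulrN1 opprK mul1r; under eq_fun do rewrite mulN1r.
  by rewrite derive1_opp mulrN opprK.
- rewrite expr0 mulr1 mulN1r; under eq_fun do rewrite mul1r.
  by [].
Qed.

End opposite.

Section filters.
Context {R : realType}.

Lemma cvg_at_right0 (F : set_system R) (FF : ProperFilter F) (p : R -> R) :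
  p x @[x --> F] --> 0 -> (\forall x \near F, 0 < p x) -> p x @[x --> F] --> 0^'+.
Proof.
move=> p0 p_gt0 U U0; have := p0 _ U0.
by apply: filterS2 p_gt0 => x px; apply.
Qed.

Lemma near_eq_cvg_to (F : set_system R) (FF : Filter F) (h g : R -> R) (l : R) :
  (\forall x \near F, h x = g x) -> h x @[x --> F] --> l -> g x @[x --> F] --> l.
Proof. by move=> hg; apply: cvg_trans; exact: near_eq_cvg. Qed.

End filters.

Section endpoints.
Context {R : realType}.
Variables (a b gam : R) (n : nat) (f p : R -> R) (A : nat -> R).

(** A negative exponent gam - k would destroy the limit where p vanishes. The disjunction prevents
    this: either every coefficient is 0, or the exponents are the natural numbers n - k, and the
    power agrees with [^+] at 0 too. *)
Lemma cvg_polynomial_part (F : set_system R) (FF : ProperFilter F) x0 :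
  (forall k, (1 <= k < n.+1)%N -> A k = 0) \/ gam = n%:R ->
  0 <= p x0 -> (\forall x \near F, 0 <= p x) ->
  p x @[x --> F] --> p x0 -> f x @[x --> F] --> f x0 ->
  (f x - \sum_(1 <= k < n.+1) p x `^ (gam - k%:R) * A k) @[x --> F] -->
  (f x0 - \sum_(1 <= k < n.+1) p x0 `^ (gam - k%:R) * A k : R).
Proof.
move=> [A0|gamE] p0 pF pcvg fcvg.
  have S0 x : \sum_(1 <= k < n.+1) p x `^ (gam - k%:R) * A k = 0.
    by rewrite big_nat_cond big1// => k /andP[kn _]; rewrite A0// mulr0.
  under eq_fun do rewrite S0; rewrite S0.
  by apply: cvgB => //; exact: cvg_cst.
have SE x : 0 <= p x -> \sum_(1 <= k < n.+1) p x `^ (gam - k%:R) * A k =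
    \sum_(1 <= k < n.+1) p x ^+ (n - k) * A k.
  move=> px; apply: eq_big_nat => k /andP[_ kn].
  by rewrite gamE -natrB// powR_mulrn.
rewrite SE//.
have : (f x - \sum_(1 <= k < n.+1) p x ^+ (n - k) * A k) @[x --> F] -->
    (f x0 - \sum_(1 <= k < n.+1) p x0 ^+ (n - k) * A k : R).
  apply: cvgB => //; apply: cvg_big; first exact: add_continuous.
  move=> k _; apply: cvgM; last exact: cvg_cst.
  apply: (@cvg_comp _ _ _ p (fun y => y ^+ (n - k)) _ (nbhs (p x0))) => //.
  exact: exprn_continuous.
apply: cvg_trans; apply: near_eq_cvg.
by apply: filterS pF => x px; rewrite SE.
Qed.

Lemma eq_with_endlim_of (g : R -> R) : a < b ->
  (forall k, (1 <= k < n.+1)%N -> A k = 0) \/ gam = n%:R ->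
  (forall x, a <= x <= b -> 0 <= p x) ->
  {within `[a, b], continuous p} -> {within `[a, b], continuous f} ->
  (forall x, a < x < b -> g x = f x - \sum_(1 <= k < n.+1) p x `^ (gam - k%:R) * A k) ->
  eq_with_endlim a b g (fun x => f x - \sum_(1 <= k < n.+1) p x `^ (gam - k%:R) * A k).
Proof.
move=> ab hA p0 cp cf gE; split.
- by move=> x; rewrite inE/= in_itv/=; exact: gE.
- have [_ pa _] := (continuous_within_itvP p ab).1 cp.
  have [_ fa _] := (continuous_within_itvP f ab).1 cf.
  have pa0 : 0 <= p a by apply: p0; rewrite lexx ltW.
  have pF : \forall x \near a^'+, 0 <= p x.
    by apply: filterS (near_itv_right ab) => x xab; apply: p0; lra.
  apply: near_eq_cvg_to (@cvg_polynomial_part a^'+ _ a hA pa0 pF pa fa).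
  by apply: filterS (near_itv_right ab) => x xab; rewrite gE.
- have [_ _ pb] := (continuous_within_itvP p ab).1 cp.
  have [_ _ fb] := (continuous_within_itvP f ab).1 cf.
  have pb0 : 0 <= p b by apply: p0; rewrite lexx ltW.
  have pF : \forall x \near b^'-, 0 <= p x.
    by apply: filterS (near_itv_left ab) => x xab; apply: p0; lra.
  apply: near_eq_cvg_to (@cvg_polynomial_part b^'- _ b hA pb0 pF pb fb).
  by apply: filterS (near_itv_left ab) => x xab; rewrite gE.
Qed.

End endpoints.

Section inverse.
Context {R : realType}.
Variables (a b : R) (psi : R -> R).
Hypothesis ab : a < b.
Hypothesis psi_incr : {in `[a, b]%R &, {homo psi : x y / x < y}}.
Hypothesis psi_cont : {within `[a, b], continuous psi}.

(** The intermediate value theorem provides the preimages from which g is chosen; its continuity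
    comes from that of psi on the segment together with [cancel psi g]. *)
Lemma incr_inverse : exists g : R -> R,
  [/\ forall x, a < x < b -> g (psi x) = x,
      forall y, psi a < y < psi b -> a < g y < b,
      forall y, psi a < y < psi b -> psi (g y) = y &
      forall y, psi a < y < psi b -> {for y, continuous g}].
Proof.
have psi_ab : psi a < psi b by apply: psi_incr => //; rewrite in_itv/= ?lexx ltW.
have inj : {in `[a, b]%R &, injective psi}.
  move=> x y xab yab xy; have [h|h|//] := ltgtP x y.
    by have := psi_incr xab yab h; rewrite xy ltxx.
  by have := psi_incr yab xab h; rewrite xy ltxx.
pose g y := xget a [set x | x \in `[a, b]%R /\ psi x = y].
have gP y : psi a <= y <= psi b -> g y \in `[a, b]%R /\ psi (g y) = y.
  move=> yab; have [x xab xy] : exists2 x, x \in `[a, b]%R & psi x = y.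
    by apply: IVT => //; [exact: ltW|rewrite min_l ?max_r ?(ltW psi_ab)].
  exact: (@xgetPex _ a [set x | x \in `[a, b]%R /\ psi x = y] (ex_intro _ x (conj xab xy))).
have le_psi x : x \in `[a, b]%R -> psi a <= psi x <= psi b.
  move=> xab; move: (xab); rewrite in_itv/= => /andP[ax xb]; apply/andP; split.
    move: ax; rewrite le_eqVlt => /predU1P[->//|ax].
    by apply/ltW/psi_incr => //; rewrite in_itv/= lexx ltW.
  move: xb; rewrite le_eqVlt => /predU1P[->//|xb].
  by apply/ltW/psi_incr => //; rewrite in_itv/= lexx ltW.
have gK : {in `[a, b]%R, cancel psi g}.
  by move=> x xab; have [gx E] := gP _ (le_psi x xab); apply: inj.
have cg := segment_can_le_continuous (ltW ab) psi_cont gK.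
exists g; split.
- by move=> x xab; apply: gK; rewrite in_itv/=; lra.
- move=> y yab; have [|gy E] := gP y; first by lra.
  move: gy yab; rewrite in_itv/= -{3 4}E => /andP[ag gb] /andP[h1 h2].
  apply/andP; split; rewrite lt_neqAle ?ag ?gb andbT; apply/eqP => e.
    by move: h1; rewrite -e ltxx.
  by move: h2; rewrite e ltxx.
- by move=> y yab; have [|_ E] := gP y; first by lra.
- move=> y yab; have [c _ _] := (continuous_within_itvP g psi_ab).1 cg.
  by apply: c; rewrite in_itv.
Qed.

End inverse.

(** * The two expansion formulas *)

Theorem theorem5 (R : realType) (a b : R) (n : nat) (alpha beta gamma : R)
    (psi f : R -> R)
    (ltab : a < b) (n_gt0 : (0 < n)%N)
    (halpha : n%:R - 1 < alpha < n%:R)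
    (hbeta : 0 <= beta <= 1)
    (hgamma : gamma = alpha + beta * (n%:R - alpha))
    (psiCn : Cn_on n a b psi)
    (psi_incr : {in `[a, b] &, {homo psi : x y / x < y}})
    (dpsi_neq0 : {in `[a, b], forall x, endval a b (derive1 psi) x != 0})
    (fCn : Cn_on n a b f) :
  let xi := (1 - beta) * (n%:R - alpha) in
  let dIa k := iter (n - k) (dpsi psi) (fint_left psi a xi f) in
  let dIb k := iter (n - k) (dpsi psi) (fint_right psi b xi f) in
  ((forall k : nat, (1 <= k <= n)%N -> cvg (dIa k x @[x --> a^'+])) ->
   eq_with_endlim a b
     (fint_left psi a alpha (hilfer_left psi n a alpha beta f))
     (fun x => f x - \sum_(1 <= k < n.+1)
        (psi x - psi a) `^ (gamma - k%:R) / Gamma (gamma - k%:R + 1)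
        * endval a b (dIa k) a)) /\
  ((forall k : nat, (1 <= k <= n)%N -> cvg (dIb k x @[x --> b^'-])) ->
   eq_with_endlim a b
     (fint_right psi b alpha (hilfer_right psi n b alpha beta f))
     (fun x => f x - \sum_(1 <= k < n.+1)
        (-1) ^+ (n - k) * (psi b - psi x) `^ (gamma - k%:R)
        / Gamma (gamma - k%:R + 1)
        * endval a b (dIb k) b)).
Proof.
move=> xi dIa dIb.
have /andP[alpha_gt alpha_lt] := halpha; have /andP[beta0 beta1] := hbeta.
have na0 : 0 < n%:R - alpha by rewrite subr_gt0.
have n1 : 1 <= n%:R :> R by rewrite ler1n.
have alpha0 : 0 <= alpha by lra.
have xi01 : 0 <= xi < 1.
  rewrite /xi mulr_ge0 ?subr_ge0 ?(ltW alpha_lt)//=.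
  by apply: (@le_lt_trans _ _ (n%:R - alpha)); [rewrite ger_pMl//|]; lra.
pose eta := beta * (n%:R - alpha).
have eta0 : 0 <= eta by rewrite mulr_ge0// ltW.
have sum_n : alpha + eta = n%:R - xi by rewrite /eta /xi; ring.
have gammaE : gamma = n%:R - xi by rewrite hgamma -sum_n.
have [psi_cont _] := psiCn; have [f_cont _] := fCn.
have incr : {in `[a, b]%R &, {homo psi : x y / x < y}}.
  by move=> x y xab yab; apply: psi_incr; rewrite inE.
have psi_ab : psi a < psi b by apply: incr => //; rewrite in_itv/= lexx ltW.
have psi_smooth := Cn_on_smooth ltab psiCn.
have f_smooth := Cn_on_smooth ltab fCn.
have : smooth a b 1 psi by exact: smooth_le psi_smooth.
move=> [psi_cont' _ [psi_der psi'_smooth]].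
have [psi'_cont [l [r [psi'l psi'r]]] _] := psi'_smooth.
have psi'_nv : nonvanishing a b (derive1 psi).
  have nz x : a <= x <= b -> endval a b (derive1 psi) x != 0.
    by move=> xab; apply: dpsi_neq0; rewrite inE/= in_itv.
  split.
    move=> x /andP[ax xb]; have := nz x.
    by rewrite /endval (gt_eqF ax) (lt_eqF xb); apply; rewrite !ltW.
  exists l, r; split => //.
    have := nz a; rewrite /endval eqxx (cvg_lim (@Rhausdorff R) psi'l).
    by apply; rewrite lexx ltW.
  have := nz b; rewrite /endval (gt_eqF ltab) eqxx (cvg_lim (@Rhausdorff R) psi'r).
  by apply; rewrite lexx ltW.
have psi'_ge0 x : a < x < b -> 0 <= derive1 psi x.
  move=> xab; apply: (@incr_derive1_ge0_itv _ psi true false a b) => //.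
  by move=> y; rewrite inE/= in_itv/=; exact: psi_der.
have [g [gK g_itv Kg g_cont]] := incr_inverse ltab incr psi_cont.
have psi_itv x : a < x < b -> psi a < psi x < psi b.
  by move=> xab; apply/andP; split; apply: incr; rewrite ?in_itv/=; lra.
pose L := psi b - psi a.
have L0 : 0 < L by rewrite subr_gt0.
(* Restricted to s > 0: at s = 0 and k = gamma the power is 1 while [kern] is 0. The endpoints are
   therefore reached through limits of the right-hand side itself. *)
have coefE s k : 0 < s -> kern (n%:R - xi - k%:R + 1) s =
    s `^ (gamma - k%:R) / Gamma (gamma - k%:R + 1).
  by move=> s0; rewrite (kern_gt0E _ s0) gammaE addrK.
have psi_le x : a <= x <= b -> psi a <= psi x <= psi b.
  move=> xab; apply/andP; split; apply: (ltW_homo_in incr); rewrite ?in_itv/=; lra.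
have psi_derive x : a < x < b -> is_derive x 1 psi (derive1 psi x).
  by move=> xab; rewrite derive1E; exact: derivableP (psi_der x xab).
have [_ psi_a psi_b] := (continuous_within_itvP psi ltab).1 psi_cont.
(* Turns the last clause of [one_sided_taylor] into the disjunction that governs the limits at the
   endpoints; xi = 0 means gamma = n. *)
have xi_case (C : nat -> R) : (0 < xi -> forall k, (1 <= k < n.+1)%N -> C k = 0) ->
    (forall k, (1 <= k < n.+1)%N -> C k = 0) \/ gamma = n%:R.
  move=> C0; have [xi00|xi_neq0] := eqVneq xi 0.
    by right; rewrite gammaE xi00 subr0.
  by left; apply: C0; rewrite lt_neqAle eq_sym xi_neq0; case/andP: xi01.
split.
- move=> cvg_dIa.
  pose p x := psi x - psi a; pose phi s := g (psi a + s).
  have E_lim h : has_lims a b h -> cvg (h x @[x --> a^'+]).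
    by move=> [u [v [hu _]]]; apply/cvg_ex; exists u.
  have p_itv x : a < x < b -> 0 < p x < L by move=> /psi_itv; rewrite /p /L; lra.
  have s_itv s : 0 < s < L -> psi a < psi a + s < psi b by rewrite /L; lra.
  have phi_itv s : 0 < s < L -> a < phi s < b by move=> /s_itv; exact: g_itv.
  have pK x : a < x < b -> phi (p x) = x by move=> xab; rewrite /phi /p subrKC gK.
  have phiK s : 0 < s < L -> p (phi s) = s.
    by move=> /s_itv sL; rewrite /phi /p Kg// addrC addKr.
  have phi_cont s : 0 < s < L -> {for s, continuous phi}.
    move=> /s_itv /g_cont cg.
    apply: (@cvg_comp _ _ _ (fun s => psi a + s) g _ (nbhs (psi a + s))) => //.
    by apply: cvgD; [exact: cvg_cst|exact: cvg_id].
  have p_der x : a < x < b -> is_derive x 1 p (1 * derive1 psi x).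
    move=> xab; apply: is_derive_eq
      (is_deriveB (psi_derive _ xab) (is_derive_cst (psi a) x (1 : R))) _.
    by rewrite subr0 mul1r.
  have p_cvg : p x @[x --> a^'+] --> 0^'+.
    apply: cvg_at_right0; last by apply: filterS (near_itv_right ltab) => x /p_itv /andP[].
    by rewrite -[X in _ --> X](subrr (psi a)); apply: cvgB => //; exact: cvg_cst.
  have fIE m (h H : R -> R) : 0 <= m ->
      (forall s, 0 < s < L -> {for s, continuous H}) -> (forall s, s <= 0 -> H s = 0) ->
      (forall x, a < x < b -> h x = H (p x)) ->
      forall x, a < x < b -> fint_left psi a m h x = frac_int m H (p x).
    by move=> m0 cH H0 hH x xab; exact: (fint_leftE incr).
  have T1 : (fun h x => 1 * dpsi psi h x) = dpsi psi.
    by apply/funext => h; apply/funext => x; rewrite mul1r.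
  have := one_sided_taylor ltab n_gt0 L0 psi_smooth psi'_nv f_smooth (mulr1 1) _
    (near_itv_right ltab) E_lim p_itv phi_itv pK phiK phi_cont p_der p_cvg fIE
    xi01 eta0 alpha0 sum_n.
  rewrite T1 => /(_ _)[i iltn|ostE ost0].
    have := cvg_dIa (n - i)%N; rewrite /dIa subKn ?(ltnW iltn)//; apply.
    by rewrite subn_gt0 iltn leq_subr.
  pose A k := (Gamma (gamma - k%:R + 1))^-1 * lim (dIa k x @[x --> a^'+]).
  rewrite (_ : (fun x => _) = fun x => f x - \sum_(1 <= k < n.+1) p x `^ (gamma - k%:R) * A k);
    last first.
    by apply/funext => x; congr (_ - _); apply: eq_bigr => k _; rewrite /endval eqxx mulrA.
  apply: eq_with_endlim_of => //.
  + apply: xi_case => xi_gt0 k /andP[k0 kn].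
    by rewrite /A /dIa ost0 ?mulr0// -{2}(subn0 n) ltn_sub2l.
  + by move=> x /psi_le; rewrite /p; lra.
  + by move=> x; apply: cvgB; [exact: psi_cont|exact: cvg_cst].
  + move=> x xab; rewrite [LHS]ostE//; congr (_ - _); apply: eq_big_nat => k _.
    have /andP[px0 _] := p_itv x xab.
    by rewrite (coefE _ k px0) mulrA.
- move=> cvg_dIb.
  pose p x := psi b - psi x; pose phi s := g (psi b - s).
  pose S j := iter j (fun h x => - dpsi psi h x) (fint_right psi b xi f).
  have E_lim h : has_lims a b h -> cvg (h x @[x --> b^'-]).
    by move=> [u [v [_ hv]]]; apply/cvg_ex; exists v.
  have p_itv x : a < x < b -> 0 < p x < L by move=> /psi_itv; rewrite /p /L; lra.
  have s_itv s : 0 < s < L -> psi a < psi b - s < psi b by rewrite /L; lra.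
  have phi_itv s : 0 < s < L -> a < phi s < b by move=> /s_itv; exact: g_itv.
  have pK x : a < x < b -> phi (p x) = x by move=> xab; rewrite /phi /p subKr gK.
  have phiK s : 0 < s < L -> p (phi s) = s.
    by move=> /s_itv sL; rewrite /phi /p Kg// subKr.
  have phi_cont s : 0 < s < L -> {for s, continuous phi}.
    move=> /s_itv /g_cont cg.
    apply: (@cvg_comp _ _ _ (fun s => psi b - s) g _ (nbhs (psi b - s))) => //.
    by apply: cvgB; [exact: cvg_cst|exact: cvg_id].
  have p_der x : a < x < b -> is_derive x 1 p (- 1 * derive1 psi x).
    move=> xab; apply: is_derive_eq
      (is_deriveB (is_derive_cst (psi b) x (1 : R)) (psi_derive _ xab)) _.
    by rewrite sub0r mulN1r.
  have p_cvg : p x @[x --> b^'-] --> 0^'+.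
    apply: cvg_at_right0; last by apply: filterS (near_itv_left ltab) => x /p_itv /andP[].
    by rewrite -[X in _ --> X](subrr (psi b)); apply: cvgB => //; exact: cvg_cst.
  have fIE m (h H : R -> R) : 0 <= m ->
      (forall s, 0 < s < L -> {for s, continuous H}) -> (forall s, s <= 0 -> H s = 0) ->
      (forall x, a < x < b -> h x = H (p x)) ->
      forall x, a < x < b -> fint_right psi b m h x = frac_int m H (p x).
    by move=> m0 cH H0 hH x xab; exact: (fint_rightE incr).
  have TN : (fun h x => - 1 * dpsi psi h x) = (fun h x => - dpsi psi h x).
    by apply/funext => h; apply/funext => x; rewrite mulN1r.
  (* The one-sided formula concerns the iterates of [- dpsi], the statement those of [dpsi]; this is
     where the sign (-1)^(n - k) enters. *)
  have cvgS k : (1 <= k < n.+1)%N ->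
      S (n - k)%N x @[x --> b^'-] --> (-1) ^+ (n - k) * lim (dIb k x @[x --> b^'-]).
    move=> kn; rewrite /S iter_dpsiN; apply: cvgM; first exact: cvg_cst.
    exact: cvg_dIb.
  have limS k : (1 <= k < n.+1)%N ->
      lim (S (n - k)%N x @[x --> b^'-]) = (-1) ^+ (n - k) * lim (dIb k x @[x --> b^'-]).
    by move=> kn; apply: cvg_lim => //; exact: cvgS.
  have := one_sided_taylor ltab n_gt0 L0 psi_smooth psi'_nv f_smooth (etrans (mulrNN 1 1) (mulr1 1)) _
    (near_itv_left ltab) E_lim p_itv phi_itv pK phiK phi_cont p_der p_cvg fIE
    xi01 eta0 alpha0 sum_n.
  rewrite TN => /(_ _)[i iltn|ostE ost0].
    have nk : (1 <= n - i < n.+1)%N by rewrite subn_gt0 iltn ltnS leq_subr.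
    have := cvgS (n - i)%N nk; rewrite subKn ?(ltnW iltn)// => Sl.
    by apply/cvg_ex; eexists; exact: Sl.
  pose A k := (Gamma (gamma - k%:R + 1))^-1 * lim (S (n - k)%N x @[x --> b^'-]).
  rewrite (_ : (fun x => _) = fun x => f x - \sum_(1 <= k < n.+1) p x `^ (gamma - k%:R) * A k);
    last first.
    apply/funext => x; congr (_ - _); apply: eq_big_nat => k kn.
    by rewrite /endval (gt_eqF ltab) eqxx /A limS// -!mulrA mulrCA; congr (_ * _); rewrite mulrCA.
  apply: eq_with_endlim_of => //.
  + apply: xi_case => xi_gt0 k /andP[k0 kn].
    by rewrite /A ost0 ?mulr0// -{2}(subn0 n) ltn_sub2l.
  + by move=> x /psi_le; rewrite /p; lra.
  + by move=> x; apply: cvgB; [exact: cvg_cst|exact: psi_cont].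
  + move=> x xab; rewrite [LHS]ostE//; congr (_ - _); apply: eq_big_nat => k _.
    have /andP[px0 _] := p_itv x xab.
    by rewrite (coefE _ k px0) mulrA.
Qed.
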